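(* Let $m_1,n\ge1$ be integers, $m=2m_1$, let $T\subset\overline{1,2n}$, and let $k\in\mathbb N$. Consider the $osp(2m_1,2n)$-module $\mathcal A'_k$ (depending on $T$) and the sets $S_1,T_1$ defined in the context. The following statements hold. 1) The submodule $\mathcal A'_k$ is irreducible when $S_1\cup T_1\ne\emptyset$. In particular, $\mathcal A'_k$ is not of highest weight type if $S_1\ne\emptyset$ and $T_1\neq\emptyset$. 2) Suppose $S_1=\emptyset$ and $T_1=\emptyset$. By symmetry we may assume $T=\overline{1,n}$. a) The submodule $\mathcal A'_k$ is irreducible when $k\ne m_1$. b) The submodule $$\mathcal A'_{m_1}=\langle\theta_1\cdots\theta_{m_1}\rangle\oplus\langle(x_{n-1}x_{2n}-x_nx_{2n-1})\theta_1\cdots\theta_{m_1}\rangle$$ is a direct sum of two irreducible submodules.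
   Context: $\mathbb N$ is the set of nonnegative integers, $\overline{i,j}=\{i,i+1,\dots,j\}$. $E_{i,j}$ is the square matrix with $(i,j)$-entry $1$ and others zero. The Lie superalgebra $gl(m,2n)$ of $(m+2n)\times(m+2n)$ complex matrices has even part spanned by $E_{i,j}$ ($i,j\in\overline{1,m}$) and $E_{m+s,m+t}$ ($s,t\in\overline{1,2n}$), odd part spanned by $E_{i,m+s},E_{m+s,i}$ ($i\in\overline{1,m}$, $s\in\overline{1,2n}$), and bracket $[u,v]=uv-(-1)^{\iota_1\iota_2}vu$ for $u,v$ of parities $\iota_1,\iota_2$. For $m=2m_1$, $osp(m,2n)$ is the subalgebra of matrices $$\begin{pmatrix}A&B&H&H_1\\ C&-A^T&K&K_1\\ K_1^T&H_1^T&D&E\\ -K^T&-H^T&F&-D^T\end{pmatrix}$$ with $A,B,C$ of size $m_1\times m_1$, $B=-B^T$, $C=-C^T$; $D,E,F$ of size $n\times n$, $E=E^T$, $F=F^T$; $H,H_1,K,K_1$ of size $m_1\times n$. $\mathcal A'=\mathbb C[x_1,\dots,x_{2n};\theta_1,\dots,\theta_m]$ is the polynomial algebra in commuting (bosonic) variables $x_i$ and anticommuting (fermionic) variables $\theta_p$ ($x_i\theta_p=\theta_px_i$); $\partial_{\theta_p}$ is the odd (left) derivation with $\partial_{\theta_p}(\theta_q)=\delta_{p,q}$. Let $\bar T=\overline{1,2n}\setminus T$. The algebra $osp(m,2n)$ acts on $\mathcal A'$ via: - $E_{p,q}\mapsto\theta_p\partial_{\theta_q}$ for $p,q\in\overline{1,m}$;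 - $E_{m+i,m+j}\mapsto -x_j\partial_{x_i}-\delta_{i,j}$ if $i,j\in T$; $\partial_{x_i}\partial_{x_j}$ if $i\in T,j\in\bar T$; $-x_ix_j$ if $i\in\bar T,j\in T$; $x_i\partial_{x_j}$ if $i,j\in\bar T$; - for $p\in\overline{1,m}$: $E_{m+i,p}\mapsto\partial_{x_i}\partial_{\theta_p}$ if $i\in T$, and $x_i\partial_{\theta_p}$ if $i\in\bar T$; - for $p\in\overline{1,m}$: $E_{p,m+j}\mapsto-\theta_px_j$ if $j\in T$, and $\theta_p\partial_{x_j}$ if $j\in\bar T$. For $k\in\mathbb N$, $\mathcal A'_k$ is the span of all $x^\alpha\theta_{i_1}\cdots\theta_{i_t}$ with $t\in\overline{0,m}$, $i_1,\dots,i_t\in\overline{1,m}$, $\alpha\in\mathbb N^{2n}$ and $\sum_{i\in\bar T}\alpha_i-\sum_{i\in T}\alpha_i=k-t$; it is an $osp(m,2n)$-submodule. $S_1=\{i\in\overline{1,2n}\mid i\in\bar T,\ n+i\in\bar T\}$ and $T_1=\{i\in\overline{1,2n}\mid i\in T,\ n+i\in T\}$. $\langle F\rangle$ denotes the $osp(m,2n)$-submodule generated by $F$ (for a single element $f$, $\langle f\rangle$ is the submodule generated by $f$). The Cartan subalgebra is spanned by $E_{i,i}-E_{m_1+i,m_1+i}$ ($1\le i\le m_1$) and $E_{2m_1+j,2m_1+j}-E_{2m_1+n+j,2m_1+n+j}$ ($1\le j\le n$). Let $osp(2m_1,2n)^+$ be the span of $E_{i,j}-E_{m_1+j,m_1+i}$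 and $E_{i,m_1+j}-E_{j,m_1+i}$ ($1\le i<j\le m_1$), $E_{2m_1+p,2m_1+q}-E_{2m_1+n+q,2m_1+n+p}$ ($1\le p<q\le n$), $E_{2m_1+p,2m_1+n+q}+E_{2m_1+q,2m_1+n+p}$ ($1\le p\le q\le n$), $E_{i,2m_1+q}-E_{2m_1+n+q,m_1+i}$ and $E_{i,2m_1+n+q}+E_{2m_1+q,m_1+i}$ ($1\le i\le m_1$, $1\le q\le n$). A highest weight vector is a (nonzero) weight vector annihilated by $osp(2m_1,2n)^+$; a module is of highest weight type if it is generated by a highest weight vector.
   Formalization: In 1), irreducibility is stated only for k ≤ 2m_1 when T is all of {1,…,2n}, since A'_k = 0 for larger k; in 2b) with n = 1, where x_{n-1} does not exist, the second summand is only asserted to be some irreducible submodule. *)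

(* Defs.v *)
(* MathComp; the complex numbers are R[i] for an arbitrary R : realType. *)
From HB Require Import structures.
From mathcomp Require Import all_boot all_order all_algebra.
From mathcomp Require Import reals complex mpoly ring.

Set Implicit Arguments.
Unset Strict Implicit.
Unset Printing Implicit Defensive.

Import Order.TTheory GRing.Theory Num.Theory.
Local Open Scope ring_scope.

Section LinearSubspaces.
Variables (K : fieldType) (V : lmodType K).
Implicit Types F U W : V -> Prop.

Definition is_subspace U : Prop :=
  U 0 /\ forall (c : K) (u v : V), U u -> U v -> U (c *: u + v).

Definition span F (v : V) : Prop :=
  forall U, is_subspace U -> (forall w, F w -> U w) -> U v.

Definition direct_sum U W1 W2 : Prop :=
  (forall v, U v <-> exists w1 w2, [/\ W1 w1, W2 w2 & v = w1 + w2]) /\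
  (forall v, W1 v -> W2 v -> v = 0).

End LinearSubspaces.

(* All indices are 0-based.  The m fermionic variables theta_p are indexed by
   'I_m and the N bosonic variables x_i by 'I_N. *)
Section SuperPolynomials.
Variables (K : fieldType) (m N : nat).

(* C[x_1..x_N; theta_1..theta_m] as a free C[x]-module on the products
   theta_S of the theta_p, p in S, taken in increasing order of p: the family
   f stands for \sum_S f_S theta_S. *)
Definition superpoly := {ffun {set 'I_m} -> {mpoly K[N]}}.

Implicit Types (f : superpoly) (p q : 'I_m) (i : 'I_N) (S : {set 'I_m}).

(* The sign picked up when theta_p moves to its place in theta_S. *)
Definition theta_sign p S : {mpoly K[N]} :=
  (-1) ^+ #|[set q in S | (q < p)%N]|.

(* Left multiplication by theta_p, and the left odd derivation along it. *)
Definition theta p f : superpoly :=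
  [ffun S : {set 'I_m} => if p \in S then theta_sign p S * f (S :\ p) else 0].
Definition dtheta p f : superpoly :=
  [ffun S : {set 'I_m} =>
     if p \in S then 0 else theta_sign p S * f (p |: S)].

Definition xmul i f : superpoly := [ffun S : {set 'I_m} => 'X_i * f S].
Definition dx i f : superpoly := [ffun S : {set 'I_m} => mderiv i (f S)].

(* x^alpha and, more generally, x^alpha theta_(s_1) ... theta_(s_t). *)
Definition xmono (alpha : 'X_{1..N}) : superpoly :=
  [ffun S : {set 'I_m} => if S == set0 then 'X_[alpha] else 0].
Definition supermono (alpha : 'X_{1..N}) (s : seq 'I_m) : superpoly :=
  foldr theta (xmono alpha) s.

(* The Clifford relations theta_anticomm, dtheta_theta and dtheta_xmono confirm
   that the signs above are those of the anticommuting variables and of the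
   left odd derivation with dtheta_p (theta_q) = delta_(p,q). *)
Lemma theta_signD1 p q S : q \in S ->
  theta_sign p (S :\ q) = (-1) ^+ (q < p)%N * theta_sign p S.
Proof.
move=> qS; rewrite /theta_sign; case: (ltnP q p) => [qp|pq] /=; last first.
  rewrite mul1r; congr (_ ^+ _); apply: eq_card => r; rewrite !inE.
  by case: eqVneq => [->|] //=; rewrite ltnNge pq andbF.
rewrite (cardsD1 q [set r in S | _]) inE qS qp /= exprD mulrA -expr2 sqrr_sign.
rewrite mul1r; congr (_ ^+ _); apply: eq_card => r.
by rewrite !inE andbA.
Qed.

Lemma theta_sign_sqr p S : theta_sign p S * theta_sign p S = 1.
Proof. by rewrite -expr2 /theta_sign sqrr_sign. Qed.

Lemma theta_anticomm p q f : theta p (theta q f) = - theta q (theta p f).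
Proof.
apply/ffunP=> S; rewrite !ffunE !inE.
case: (eqVneq p q) => [<-|pq] /=.
  by case: ifP; rewrite ?mulr0 ?oppr0.
case pS: (p \in S); case qS: (q \in S) => //=; rewrite ?mulr0 ?oppr0 //.
have -> : S :\ q :\ p = S :\ p :\ q.
  by apply/setP=> r; rewrite !inE andbCA.
rewrite !theta_signD1 //.
case: (ltngtP p q) => [_|_|/val_inj E]; last by rewrite E eqxx in pq.
  by rewrite /= expr0 expr1; ring.
by rewrite /= expr0 expr1; ring.
Qed.

Lemma dtheta_theta p q f :
  dtheta p (theta q f) = (if p == q then f else 0) - theta q (dtheta p f).
Proof.
apply/ffunP=> S; rewrite !ffunE !inE.
case: (eqVneq p q) => [<-|pq] /=.
  case pS: (p \in S); rewrite ?ffunE ?inE ?eqxx /= ?subr0.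
    by rewrite setD1K // theta_signD1 // ltnn mul1r mulrA theta_sign_sqr
               mul1r subrr.
  rewrite setU1K ?pS // mulrA.
  have <- : theta_sign p (p |: S) = theta_sign p S.
    rewrite -[in RHS](@setU1K _ p S) ?pS // theta_signD1 ?setU11 //.
    by rewrite ltnn mul1r.
  by rewrite theta_sign_sqr mul1r.
rewrite ?ffunE sub0r.
case pS: (p \in S); case qS: (q \in S) => //=; rewrite ?mulr0 ?oppr0 //.
have -> : (p |: S) :\ q = p |: (S :\ q).
  apply/setP=> r; rewrite !inE; case: (eqVneq r p) => [->|] //=.
  by rewrite pq.
have -> : theta_sign q S = (-1) ^+ (p < q)%N * theta_sign q (p |: S).
  by rewrite -theta_signD1 ?setU11 // setU1K ?pS.
rewrite theta_signD1 //.
case: (ltngtP p q) => [_|_|/val_inj E]; last by rewrite E eqxx in pq.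
  by rewrite /= expr0 expr1; ring.
by rewrite /= expr0 expr1; ring.
Qed.

Lemma dtheta_xmono p alpha : dtheta p (xmono alpha) = 0.
Proof.
apply/ffunP=> S; rewrite !ffunE; case: ifP => // _.
case: eqP => [/setP/(_ p)|_]; last by rewrite mulr0.
by rewrite !inE eqxx.
Qed.

End SuperPolynomials.

Section Osp.
Variables (K : fieldType) (m1 n : nat).

Local Notation m := (m1 + m1)%N.
Local Notation N := (n + n)%N.
Local Notation gl := 'M[K]_(m + N).

(* In 1-based terms: i, m1+i, 2m1+j and 2m1+n+j. *)
Definition f1 (i : 'I_m1) : 'I_(m + N) := lshift N (lshift m1 i).
Definition f2 (i : 'I_m1) : 'I_(m + N) := lshift N (rshift m1 i).
Definition b1 (j : 'I_n) : 'I_(m + N) := rshift m (lshift n j).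
Definition b2 (j : 'I_n) : 'I_(m + N) := rshift m (rshift n j).

Local Notation E i j := (delta_mx i j : gl).

Definition osp (X : gl) : Prop :=
  exists (A B C : 'M[K]_m1) (D E F : 'M[K]_n) (H H1 L L1 : 'M[K]_(m1, n)),
    [/\ B = - B^T, C = - C^T, E = E^T, F = F^T &
      X = block_mx
            (block_mx A B C (- A^T)) (block_mx H H1 L L1)
            (block_mx L1^T H1^T (- L^T) (- H^T)) (block_mx D E F (- D^T))].

Definition osp_cartan : gl -> Prop :=
  span (fun X =>
    (exists i : 'I_m1, X = E (f1 i) (f1 i) - E (f2 i) (f2 i)) \/
    (exists j : 'I_n, X = E (b1 j) (b1 j) - E (b2 j) (b2 j))).

Definition osp_plus : gl -> Prop :=
  span (fun X =>
    (exists2 ij : 'I_m1 * 'I_m1, (ij.1 < ij.2)%N &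
       X = E (f1 ij.1) (f1 ij.2) - E (f2 ij.2) (f2 ij.1) \/
       X = E (f1 ij.1) (f2 ij.2) - E (f1 ij.2) (f2 ij.1)) \/
    (exists2 pq : 'I_n * 'I_n, (pq.1 < pq.2)%N &
       X = E (b1 pq.1) (b1 pq.2) - E (b2 pq.2) (b2 pq.1)) \/
    (exists2 pq : 'I_n * 'I_n, (pq.1 <= pq.2)%N &
       X = E (b1 pq.1) (b2 pq.2) + E (b1 pq.2) (b2 pq.1)) \/
    (exists iq : 'I_m1 * 'I_n,
       X = E (f1 iq.1) (b1 iq.2) - E (b2 iq.2) (f2 iq.1) \/
       X = E (f1 iq.1) (b2 iq.2) + E (b1 iq.2) (f2 iq.1))).

Local Notation A' := (superpoly K m N).

Variable T : {set 'I_N}.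

Definition E_act (a b : 'I_(m + N)) (f : A') : A' :=
  match split a, split b with
  | inl p, inl q => theta p (dtheta q f)
  | inr i, inr j =>
      match i \in T, j \in T with
      | true, true => - xmul j (dx i f) - (if i == j then f else 0)
      | true, false => dx i (dx j f)
      | false, true => - xmul i (xmul j f)
      | false, false => xmul i (dx j f)
      end
  | inr i, inl p =>
      if i \in T then dx i (dtheta p f) else xmul i (dtheta p f)
  | inl p, inr j =>
      if j \in T then - theta p (xmul j f) else theta p (dx j f)
  end.

Definition act (X : gl) (f : A') : A' :=
  \sum_a \sum_b X a b *: E_act a b f.

Definition Aprime (k : nat) : A' -> Prop :=
  span (fun f => exists (alpha : 'X_{1..N}) (s : seq 'I_m),
    [/\ (size s <= m)%N,
        (\sum_(i in ~: T) alpha i)%N%:Z - (\sum_(i in T) alpha i)%N%:Z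
          = k%:Z - (size s)%:Z &
        f = supermono K alpha s]).

(* Submodules are not required to be Z/2-graded.  This changes nothing: the
   parity of a weight vector is determined by its weight, so a subspace stable
   under the Cartan subalgebra is automatically graded. *)
Definition is_submodule (U : A' -> Prop) : Prop :=
  is_subspace U /\ forall X f, osp X -> U f -> U (act X f).

Definition generated (f g : A') : Prop :=
  forall U, is_submodule U -> U f -> U g.

Definition irreducible (U : A' -> Prop) : Prop :=
  [/\ is_submodule U, exists2 f, U f & f != 0 &
      forall W, is_submodule W -> (forall f, W f -> U f) ->
        (forall f, W f -> f = 0) \/ (forall f, U f -> W f)].

Definition highest_weight_vector (f : A') : Prop :=
  [/\ f != 0,
      forall X, osp_cartan X -> exists c : K, act X f = c *: f &
      forall X, osp_plus X -> act X f = 0].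

Definition highest_weight_type (U : A' -> Prop) : Prop :=
  exists f, highest_weight_vector f /\ forall g, U g <-> generated f g.

(* Only i in 1..n can satisfy the conditions "i, n+i in (the complement of) T"
   defining S_1 and T_1, so both are taken inside 'I_n. *)
Definition S1 : {set 'I_n} :=
  [set i | (lshift n i \notin T) && (rshift n i \notin T)].
Definition T1 : {set 'I_n} :=
  [set i | (lshift n i \in T) && (rshift n i \in T)].

End Osp.
Arguments Aprime K m1 {n} T k _.

Section Generators.
Variables (K : fieldType) (m1 n : nat).

Definition first_half : {set 'I_(n + n)} := [set lshift n i | i : 'I_n].

(* theta_1 ... theta_m1 *)
Definition theta_top : superpoly K (m1 + m1) (n + n) :=
  supermono K 0%MM [seq lshift m1 i | i <- enum 'I_m1].

(* (x_p x_(n+q) - x_q x_(n+p)) theta_1 ... theta_m1 *)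
Definition theta_top_minor (p q : 'I_n) : superpoly K (m1 + m1) (n + n) :=
  xmul (lshift n p) (xmul (rshift n q) theta_top)
  - xmul (lshift n q) (xmul (rshift n p) theta_top).

End Generators.

(* Main.v *)
Require Import Defs.
From HB Require Import structures.
From mathcomp Require Import all_boot all_order all_algebra.
From mathcomp Require Import boolp reals complex mpoly ring zify.

(* Write z_a, d_a for the generators of the Weyl-Clifford algebra acting on A'
   (for i in T the roles of x_i and its derivative are exchanged), so that
   E_(a,b) acts by z_a d_b, and let w_a be d_(a* ) up to a sign, a* being the dual
   index.  Then osp is spanned by the Q_ab = z_a w_b + w_a z_b up to scalars, and
   gl by these and the P_ab = z_a w_b - w_a z_b.  The osp-action commutes with an
   involution exchanging z and w, and two facts replace invariant theory for the
   dual group O(2): [Q, P] is in the span of the P's, and P P' is a polynomial in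
   the Q's.  As A'_k is irreducible under gl, for an osp-submodule W the
   gl-submodules W + P W and W :&: P W of A'_k are 0 or everything.  So if W is
   proper and nonzero, A'_k = W (+) P W, the P's exchanging the two summands.
   The P's of weight zero are diagonal.  If j, j + n are both inside or both
   outside T, one of them has eigenvalues of constant sign and cannot exchange
   the summands; if S_1 and T_1 are empty, their sum over the pairs {a, a*} is the
   scalar k - m_1, so k = m_1.  In the remaining case the exchange of z and w is
   implemented by an operator sigma on A', and the eigenspaces of sigma in
   A'_(m_1) are the two irreducible summands. *)

Set Implicit Arguments.
Unset Strict Implicit.
Unset Printing Implicit Defensive.

Import Order.TTheory GRing.Theory Num.Theory.
Local Open Scope ring_scope.

(** * Subspaces and spans *)

Section Subspaces.
Variables (K : fieldType) (V : lmodType K) (U : V -> Prop).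
Hypothesis sU : is_subspace U.

Lemma subspace0 : U 0. Proof. by case: sU. Qed.

Lemma subspaceD u v : U u -> U v -> U (u + v).
Proof. by move=> Uu Uv; rewrite -[u]scale1r; apply: sU.2. Qed.

Lemma subspaceZ c u : U u -> U (c *: u).
Proof. by move=> Uu; rewrite -[_ *: _]addr0; apply: sU.2 => //; apply: sU.1. Qed.

Lemma subspaceB u v : U u -> U v -> U (u - v).
Proof. by move=> Uu Uv; apply: subspaceD => //; rewrite -scaleN1r; apply: subspaceZ. Qed.

Lemma subspace_sum (I : Type) (r : seq I) (P : pred I) (F : I -> V) :
  (forall i, P i -> U (F i)) -> U (\sum_(i <- r | P i) F i).
Proof. by move=> UF; apply: big_ind => //; [apply: subspace0 | apply: subspaceD]. Qed.

Lemma subspaceZK c u : c != 0 -> U (c *: u) -> U u.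
Proof. by move=> c0 /(subspaceZ c^-1); rewrite scalerK. Qed.

End Subspaces.

Section Span.
Variables (K : fieldType) (V : lmodType K).
Implicit Types F U W : V -> Prop.

Lemma span_subspace F : is_subspace (Defs.span F).
Proof.
split=> [U sU _|c u v Fu Fv U sU FU]; first exact: subspace0.
by apply: sU.2; [apply: Fu | apply: Fv].
Qed.

Lemma span_gen F v : F v -> Defs.span F v.
Proof. by move=> Fv U _; apply. Qed.

Lemma span_image (W : lmodType K) (f : {linear V -> W}) F (U : W -> Prop) v :
  is_subspace U -> (forall w, F w -> U (f w)) -> Defs.span F v -> U (f v).
Proof.
move=> sU fU /(_ (fun v => U (f v))); apply=> //; split=> [|c u w Uu Uw].
  by rewrite linear0; apply: subspace0.
by rewrite linearP; apply: sU.2.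
Qed.

End Span.

(** * The Weyl-Clifford algebra *)

Section Operators.
Variables (K : fieldType) (m N : nat).
Local Notation A' := (superpoly K m N).
Implicit Types (f : A') (p q : 'I_m) (i j : 'I_N).

Lemma theta_is_linear p : linear (@theta K m N p).
Proof.
move=> c f g; apply/ffunP=> S; rewrite !ffunE; case: ifP => _.
  by rewrite mulrDr scalerAr.
by rewrite scaler0 addr0.
Qed.
HB.instance Definition _ p :=
  GRing.isLinear.Build K A' A' _ (@theta K m N p) (theta_is_linear p).

Lemma dtheta_is_linear p : linear (@dtheta K m N p).
Proof.
move=> c f g; apply/ffunP=> S; rewrite !ffunE; case: ifP => _.
  by rewrite scaler0 addr0.
by rewrite mulrDr scalerAr.
Qed.
HB.instance Definition _ p :=
  GRing.isLinear.Build K A' A' _ (@dtheta K m N p) (dtheta_is_linear p).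

Lemma xmul_is_linear i : linear (@xmul K m N i).
Proof. by move=> c f g; apply/ffunP=> S; rewrite !ffunE mulrDr scalerAr. Qed.
HB.instance Definition _ i :=
  GRing.isLinear.Build K A' A' _ (@xmul K m N i) (xmul_is_linear i).

Lemma dx_is_linear i : linear (@dx K m N i).
Proof. by move=> c f g; apply/ffunP=> S; rewrite !ffunE linearP. Qed.
HB.instance Definition _ i :=
  GRing.isLinear.Build K A' A' _ (@dx K m N i) (dx_is_linear i).

Lemma thetaN p f : theta p (- f) = - theta p f. Proof. exact: linearN. Qed.
Lemma dthetaN p f : dtheta p (- f) = - dtheta p f. Proof. exact: linearN. Qed.
Lemma xmulN i f : xmul i (- f) = - xmul i f. Proof. exact: linearN. Qed.
Lemma dxN i f : dx i (- f) = - dx i f. Proof. exact: linearN. Qed.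

Lemma dtheta_anticomm p q f : dtheta p (dtheta q f) = - dtheta q (dtheta p f).
Proof.
apply/ffunP=> S; rewrite !ffunE !inE.
case: (eqVneq p q) => [<-|pq] /=.
  by case: ifP; rewrite ?mulr0 ?oppr0.

case pS: (p \in S); case qS: (q \in S) => //=; rewrite ?mulr0 ?oppr0 //.
rewrite setUCA.
have -> : theta_sign K N q (p |: S) = (-1) ^+ (p < q)%N * theta_sign K N q S.
  rewrite -[S in RHS](@setU1K _ p) ?pS // theta_signD1 ?setU11 //.
  by rewrite mulrA -expr2 sqrr_sign mul1r.
have -> : theta_sign K N p (q |: S) = (-1) ^+ (q < p)%N * theta_sign K N p S.
  rewrite -[S in RHS](@setU1K _ q) ?qS // theta_signD1 ?setU11 //.
  by rewrite mulrA -expr2 sqrr_sign mul1r.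
case: (ltngtP p q) => [_|_|/val_inj E]; last by rewrite E eqxx in pq.
  by rewrite /= expr0 expr1; ring.
by rewrite /= expr0 expr1; ring.
Qed.

Lemma xmulC i j f : xmul i (xmul j f) = xmul j (xmul i f).
Proof. by apply/ffunP=> S; rewrite !ffunE mulrCA. Qed.

Lemma dxC i j f : dx i (dx j f) = dx j (dx i f).
Proof. by apply/ffunP=> S; rewrite !ffunE mderiv_comm. Qed.

Lemma dx_xmul i j f :
  dx i (xmul j f) = xmul j (dx i f) + (if i == j then f else 0).
Proof.
apply/ffunP=> S; rewrite !ffunE mderivM mderivX mnm1E addrC.
rewrite eq_sym; case: eqVneq => [->|_]; last by rewrite scale0r mul0r ffunE.
by rewrite -[X in (X - _)%MM]add0m addmK mpolyX0 scale1r mul1r.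
Qed.

Lemma theta_xmul p i f : theta p (xmul i f) = xmul i (theta p f).
Proof.
by apply/ffunP=> S; rewrite !ffunE; case: ifP; rewrite ?mulr0 // mulrCA.
Qed.

Lemma dtheta_xmul p i f : dtheta p (xmul i f) = xmul i (dtheta p f).
Proof.
by apply/ffunP=> S; rewrite !ffunE; case: ifP; rewrite ?mulr0 // mulrCA.
Qed.

Lemma mderiv_sign i k (u : {mpoly K[N]}) :
  mderiv i ((-1) ^+ k * u) = (-1) ^+ k * mderiv i u.
Proof. by rewrite -signr_odd; case: odd; rewrite ?mulN1r ?mul1r ?linearN. Qed.

Lemma theta_dx p i f : theta p (dx i f) = dx i (theta p f).
Proof.
by apply/ffunP=> S; rewrite !ffunE; case: ifP; rewrite ?linear0 // mderiv_sign.
Qed.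

Lemma dtheta_dx p i f : dtheta p (dx i f) = dx i (dtheta p f).
Proof.
by apply/ffunP=> S; rewrite !ffunE; case: ifP; rewrite ?linear0 // mderiv_sign.
Qed.

End Operators.

Section Coefficients.
Variables (K : fieldType) (m N : nat).
Local Notation A' := (superpoly K m N).
Implicit Types (f g : A') (u : {set 'I_m} * 'X_{1..N}).

(** Coordinates in the monomial basis. They separate points, so linear identities in A' reduce to
    scalar ones settled by [ring]. *)
Definition scoef u f : K := (f u.1)@_u.2.

Lemma scoefP f g : (forall u, scoef u f = scoef u g) -> f = g.
Proof. by move=> fg; apply/ffunP=> S; apply/mpolyP=> al; apply: (fg (S, al)). Qed.

Lemma scoefD u f g : scoef u (f + g) = scoef u f + scoef u g.
Proof. by rewrite /scoef ffunE mcoeffD. Qed.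

Lemma scoefN u f : scoef u (- f) = - scoef u f.
Proof. by rewrite /scoef ffunE mcoeffN. Qed.

Lemma scoefZ u c f : scoef u (c *: f) = c * scoef u f.
Proof. by rewrite /scoef ffunE mcoeffZ. Qed.

Lemma scoef0 u : scoef u 0 = 0.
Proof. by rewrite /scoef ffunE mcoeff0. Qed.

End Coefficients.


Section WeylClifford.
Variables (K : fieldType) (m1 n : nat).
Local Notation m := (m1 + m1)%N.
Local Notation N := (n + n)%N.
Local Notation A' := (superpoly K m N).
Local Notation I := 'I_(m + N).
Variable T : {set 'I_N}.
Implicit Types (a b : I) (f : A').

Definition zop a f : A' :=
  match split a with
  | inl p => theta p f
  | inr i => if i \in T then dx i f else xmul i f
  end.

(** For an index in T the pair (z, d) is (d/dx, -x); the minus sign keeps the canonical relation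
    [d, z] = 1. *)
Definition dop a f : A' :=
  match split a with
  | inl p => dtheta p f
  | inr i => if i \in T then - xmul i f else dx i f
  end.

Lemma zop_is_linear a : linear (zop a).
Proof.
by move=> c f g; rewrite /zop; case: split => [p|i]; [|case: ifP=> _]; rewrite linearP.
Qed.
HB.instance Definition _ a :=
  GRing.isLinear.Build K A' A' _ (zop a) (zop_is_linear a).

Lemma dop_is_linear a : linear (dop a).
Proof.
move=> c f g; rewrite /dop; case: split => [p|i]; [|case: ifP=> _];
by rewrite linearP // opprD scalerN.
Qed.
HB.instance Definition _ a :=
  GRing.isLinear.Build K A' A' _ (dop a) (dop_is_linear a).

(** The constant subtracted for i = j in T is an ordering constant: - x_j d_i - delta_ij is minus
    d_i x_j. So the four bosonic cases of the action are a single formula. *)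
Lemma E_actE a b f : E_act T a b f = zop a (dop b f).
Proof.
rewrite /E_act /zop /dop; case: split => [p|i]; case: split => [q|j] //.
  by case: (j \in T); rewrite ?thetaN.
case: (i \in T); case: (j \in T); rewrite ?dxN ?xmulN //.
by rewrite dx_xmul opprD.
Qed.

Definition swap_half k (i : 'I_(k + k)) : 'I_(k + k) :=
  match split i with inl j => rshift k j | inr j => lshift k j end.

(* The index of the dual basis vector for the invariant form. *)
Definition star a : I :=
  match split a with
  | inl p => lshift N (swap_half p)
  | inr i => rshift m (swap_half i)
  end.

Definition fermi a : bool := if split a is inl _ then true else false.

Definition ksign a b : K := (-1) ^+ (fermi a && fermi b).

Definition in_b2 a : bool :=
  if split a is inr i then (if split i is inr _ then true else false) else false.

(** The invariant form is symmetric on fermionic and alternating on bosonic indices; the alternating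
    sign is carried by the second bosonic half. *)
Definition dual_sign a : K := (-1) ^+ in_b2 a.

Definition wop a f : A' := dual_sign a *: dop (star a) f.

Lemma wop_is_linear a : linear (wop a).
Proof.
by move=> c f g; rewrite /wop linearP scalerDr !scalerA mulrC.
Qed.
HB.instance Definition _ a :=
  GRing.isLinear.Build K A' A' _ (wop a) (wop_is_linear a).

Lemma split_lshift j k (i : 'I_j) : split (lshift k i) = inl i.
Proof. exact: (unsplitK (inl i)). Qed.
Lemma split_rshift j k (i : 'I_k) : split (rshift j i) = inr i.
Proof. exact: (unsplitK (inr i)). Qed.

Definition splitE := (split_lshift, split_rshift).

Lemma wopE a f : wop a f = dual_sign a *: dop (star a) f. Proof. by []. Qed.
Lemma zop_lshift p f : zop (lshift N p) f = theta p f.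
Proof. by rewrite /zop splitE. Qed.
Lemma zop_rshift i f :
  zop (rshift m i) f = if i \in T then dx i f else xmul i f.
Proof. by rewrite /zop splitE. Qed.
Lemma dop_lshift p f : dop (lshift N p) f = dtheta p f.
Proof. by rewrite /dop splitE. Qed.
Lemma dop_rshift i f :
  dop (rshift m i) f = if i \in T then - xmul i f else dx i f.
Proof. by rewrite /dop splitE. Qed.

Lemma swap_halfK k : involutive (@swap_half k).
Proof.
by move=> i; case: (split_ordP i) => j ->; rewrite /swap_half !splitE.
Qed.

Lemma starK : involutive star.
Proof.
by move=> a; case: (split_ordP a) => j ->; rewrite /star !splitE swap_halfK.
Qed.

Lemma zopC a b f : zop a (zop b f) = ksign a b *: zop b (zop a f).
Proof.
rewrite /zop /ksign /fermi; case: split => [p|i]; case: split => [q|j].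
- by rewrite expr1 scaleN1r theta_anticomm.
- by rewrite scale1r; case: (j \in T); rewrite ?(theta_dx,theta_xmul).
- by rewrite scale1r; case: (i \in T); rewrite ?(theta_dx,theta_xmul).
rewrite scale1r; case iT: (i \in T); case jT: (j \in T).
- exact: dxC.
- by rewrite dx_xmul; case: eqP => [E|_]; rewrite ?addr0 //; rewrite E jT in iT.
- by rewrite dx_xmul; case: eqP => [E|_]; rewrite ?addr0 //; rewrite E iT in jT.
- exact: xmulC.
Qed.

Lemma dopC a b f : dop a (dop b f) = ksign a b *: dop b (dop a f).
Proof.
rewrite /dop /ksign /fermi; case: split => [p|i]; case: split => [q|j].
- by rewrite expr1 scaleN1r dtheta_anticomm.
- by rewrite scale1r; case: (j \in T); rewrite ?(dtheta_dx,dthetaN,dtheta_xmul).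
- by rewrite scale1r; case: (i \in T); rewrite ?(dtheta_dx,dthetaN,dtheta_xmul).
rewrite scale1r; case iT: (i \in T); case jT: (j \in T).
- by rewrite !xmulN xmulC.
- rewrite dxN dx_xmul.
  by case: eqP => [E|_]; rewrite ?addr0 //; rewrite E iT in jT.
- rewrite dxN dx_xmul.
  by case: eqP => [E|_]; rewrite ?addr0 //; rewrite E jT in iT.
- exact: dxC.
Qed.

Lemma dop_zop a b f :
  dop a (zop b f) = ksign a b *: zop b (dop a f) + (a == b)%:R *: f.
Proof.
rewrite /zop /dop /ksign /fermi.
case: (split_ordP a) => [p ->|i ->]; case: (split_ordP b) => [q ->|j ->];
  rewrite ?splitE /=.
- rewrite expr1 scaleN1r dtheta_theta addrC (inj_eq (@lshift_inj _ _)).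
  by case: eqP; rewrite ?scale1r ?scale0r.
- rewrite scale1r eq_lrshift scale0r addr0.
  by case: (j \in T); rewrite ?(dtheta_dx,dtheta_xmul).
- rewrite scale1r eq_rlshift scale0r addr0.
  by case: (i \in T); rewrite ?(theta_dx,thetaN,theta_xmul).
rewrite scale1r (inj_eq (@rshift_inj _ _)).
case iT: (i \in T); case jT: (j \in T).
- rewrite dxN dx_xmul (eq_sym j) opprD; case: eqP => _.
    by rewrite scale1r subrK.
  by rewrite scale0r oppr0 !addr0.
- rewrite xmulN xmulC; case: eqP => [E|_]; rewrite ?scale0r ?addr0 //.
  by rewrite E jT in iT.
- rewrite dxC; case: eqP => [E|_]; rewrite ?scale0r ?addr0 //.
  by rewrite E jT in iT.
by rewrite dx_xmul; case: eqP => _; rewrite ?scale1r ?scale0r.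
Qed.

End WeylClifford.

(** * Relations between the z's and the w's, and the invariant form *)

Section Quadratic.
Variables (K : numFieldType) (m1 n : nat).
Local Notation m := (m1 + m1)%N.
Local Notation N := (n + n)%N.
Local Notation A' := (superpoly K m N).
Local Notation I := 'I_(m + N).
Variable T : {set 'I_N}.
Implicit Types (a b c d : I) (f : A').

Local Notation s := (@ksign K m1 n).
Local Notation z := (@zop K m1 n T).
Local Notation w := (@wop K m1 n T).
Local Notation eps := (@dual_sign K m1 n).

HB.instance Definition _ a :=
  GRing.isLinear.Build K A' A' _ (w a) (@wop_is_linear K m1 n T a).

Lemma ksignC a b : s a b = s b a.
Proof. by rewrite /ksign andbC. Qed.

Lemma ksign_sqr a b : s a b * s a b = 1.
Proof. by rewrite -expr2 /ksign sqrr_sign. Qed.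

Lemma fermi_star a : fermi (star a) = fermi a.
Proof. by case: (split_ordP a) => j ->; rewrite /star /fermi !splitE. Qed.

Lemma ksign_starl a b : s (star a) b = s a b.
Proof. by rewrite /ksign fermi_star. Qed.

Lemma eps_star a : eps (star a) = - s a a * eps a.
Proof.
case: (split_ordP a) => j ->.
  by rewrite /eps /in_b2 /ksign /fermi /star !splitE /= expr1 opprK mul1r.
case: (split_ordP j) => i ->;
by rewrite /eps /in_b2 /ksign /fermi /star /swap_half !splitE /=; ring.
Qed.

Lemma eps_sqr a : eps a * eps a = 1.
Proof. by rewrite -expr2 /eps sqrr_sign. Qed.

Definition kform a b : K := eps a * (star a == b)%:R.

(** Skew-symmetry in the super sense: symmetric for two fermionic indices, alternating for two
    bosonic ones. *)
Lemma kformC a b : kform a b = - s a b * kform b a.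
Proof.
rewrite /kform; case: (eqVneq (star a) b) => [<-|ab].
  rewrite starK eqxx eps_star ksignC ksign_starl !mulr1 !mulNr mulrN opprK.
  by rewrite mulrA ksign_sqr mul1r.
rewrite mulr0; case: eqP => [E|_]; last by rewrite !mulr0.
by rewrite -E starK eqxx in ab.
Qed.

Lemma wopC a b f : w a (w b f) = s a b *: w b (w a f).
Proof.
rewrite /wop !linearZ /= dopC ksign_starl ksignC ksign_starl ksignC.
by rewrite !scalerA; congr (_ *: _); ring.
Qed.

Lemma wop_zop a b f : w a (z b f) = s a b *: z b (w a f) + kform a b *: f.
Proof.
rewrite /wop dop_zop ksign_starl linearZ /= scalerDr !scalerA /kform.
by congr (_ *: _ + _); ring.
Qed.

(** By [kformC] the constant is the one of [wop_zop]; hence exchanging z and w preserves all the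
    relations. *)
Lemma zop_wop a b f : z a (w b f) = s a b *: w b (z a f) + kform a b *: f.
Proof.
rewrite wop_zop scalerDr !scalerA [s b a]ksignC ksign_sqr scale1r.
by rewrite [kform a b]kformC -addrA -scalerDl mulNr subrr scale0r addr0.
Qed.

End Quadratic.

(** * The complement of osp in gl *)

Section Howe.
Variables (K : numFieldType) (V : lmodType K) (I : Type).
Variables (z w : I -> {linear V -> V}) (s kf : I -> I -> K).
Hypothesis zzC : forall a b f, z a (z b f) = s a b *: z b (z a f).
Hypothesis wwC : forall a b f, w a (w b f) = s a b *: w b (w a f).
Hypothesis wzC : forall a b f, w a (z b f) = s a b *: z b (w a f) + kf a b *: f.
Hypothesis zwC : forall a b f, z a (w b f) = s a b *: w b (z a f) + kf a b *: f.
Implicit Types (a b c d : I) (f g : V) (W : V -> Prop).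

Definition Qop a b f : V := z a (w b f) + w a (z b f).
Definition Pop a b f : V := z a (w b f) - w a (z b f).


Lemma Qop_is_linear a b : linear (Qop a b).
Proof.
by move=> c f g; rewrite /Qop !linearP scalerDr addrACA.
Qed.
HB.instance Definition _ a b :=
  GRing.isLinear.Build K V V _ (Qop a b) (Qop_is_linear a b).

Lemma Pop_is_linear a b : linear (Pop a b).
Proof.
by move=> c f g; rewrite /Pop !linearP addrACA -scalerDr.
Qed.
HB.instance Definition _ a b :=
  GRing.isLinear.Build K V V _ (Pop a b) (Pop_is_linear a b).

(* Separating coordinates reduce the identities in V below to scalar ones. *)
Variables (J : Type) (x : J -> V -> K).
Hypothesis xD : forall u f g, x u (f + g) = x u f + x u g.
Hypothesis xZ : forall u k f, x u (k *: f) = k * x u f.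
Hypothesis x_inj : forall f g, (forall u, x u f = x u g) -> f = g.

Let xN u f : x u (- f) = - x u f.
Proof. by rewrite -scaleN1r xZ mulN1r. Qed.

Ltac lmod_ring :=
  let u := fresh in apply: x_inj => u; rewrite !(xD, xZ, xN);
  repeat match goal with |- context [x u ?f] => move: (x u f) => ? end; ring.

(** Singly contracted terms regroup into P's. The doubly contracted scalar terms come equally from z
    w w z and w z z w, which enter Q P with opposite signs, and cancel. *)
Lemma Qop_Pop a b c d f :
  Qop a b (Pop c d f) =
    (s b c * s a c * s b d * s a d) *: Pop c d (Qop a b f)
    + (s b c * s a c * s b d * kf a d) *: Pop c b f + kf b c *: Pop a d f
    + (s b c * s a c * kf b d) *: Pop c a f
    - (s b c * s b d * kf a c) *: Pop d b f.
Proof.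
(* The relations are symmetric in z and w, so each expansion is proved once for a pair (g, h) and
   then used for (z, w) and (w, z). *)
have EE (g h : I -> {linear V -> V})
  (gC : forall i j u, g i (g j u) = s i j *: g j (g i u))
  (hC : forall i j u, h i (h j u) = s i j *: h j (h i u))
  (gh : forall i j u, g i (h j u) = s i j *: h j (g i u) + kf i j *: u)
  (hg : forall i j u, h i (g j u) = s i j *: g j (h i u) + kf i j *: u) :
  g a (h b (g c (h d f))) =
    (s b c * s a c * s b d * s a d) *: g c (h d (g a (h b f)))
     + (s b c * s a c * s b d * kf a d) *: g c (h b f) + kf b c *: g a (h d f).
  rewrite hg linearD !linearZ /= [g a (g c _)]gC [h b (h d _)]hC !linearZ /= gh.
  rewrite linearD !linearZ /=; lmod_ring.
have EE' (g h : I -> {linear V -> V})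
  (gC : forall i j u, g i (g j u) = s i j *: g j (g i u))
  (hC : forall i j u, h i (h j u) = s i j *: h j (h i u))
  (gh : forall i j u, g i (h j u) = s i j *: h j (g i u) + kf i j *: u)
  (hg : forall i j u, h i (g j u) = s i j *: g j (h i u) + kf i j *: u) :
  g a (h b (h c (g d f))) =
    (s b c * s a c * s b d * s a d) *: h c (g d (g a (h b f)))
     + (s b c * s a c * kf b d) *: h c (g a f)
     + (s b c * s b d * kf a c) *: g d (h b f)
     + (s b c * kf a c * kf b d) *: f.
  rewrite hC linearZ /= gh [h b (g d f)]hg !linearD !linearZ /=.
  rewrite [g a (g d _)]gC !linearZ /=.
  lmod_ring.
rewrite /Qop /Pop !linearB !linearD /=.
rewrite (EE z w) // (EE w z) // (EE' z w) // (EE' w z) //.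
lmod_ring.
Qed.

(** The mixed half of Q_ab Q_cd: the neighbours b and c carry operators of the same kind, which
    gives the symmetry [YopC]. *)
Definition Yop a b c d f : V :=
  z a (w b (w c (z d f))) + w a (z b (z c (w d f))).

Lemma YopC a b c d f : Yop a b c d f = s b c *: Yop a c b d f.
Proof.
by rewrite /Yop [w b (w c _)]wwC [z b (z c _)]zzC !linearZ /= scalerDr.
Qed.

(** Commuting the last two operators turns z w z w and w z w z into the mixed form with c and d
    exchanged, at the cost of a contraction. *)
Lemma Qop_Qop a b c d f :
  Qop a b (Qop c d f) =
    Yop a b c d f + s c d *: Yop a b d c f + kf c d *: Qop a b f.
Proof.
have Ez : z a (w b (z c (w d f))) =
    s c d *: z a (w b (w d (z c f))) + kf c d *: z a (w b f).
  by rewrite [z c _]zwC !linearD !linearZ.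
have Ew : w a (z b (w c (z d f))) =
    s c d *: w a (z b (z d (w c f))) + kf c d *: w a (z b f).
  by rewrite [w c _]wzC !linearD !linearZ.
rewrite /Qop /Yop !linearD /= Ez Ew; lmod_ring.
Qed.

Lemma Pop_Pop a b c d f :
  Pop a b (Pop c d f) = Qop a b (Qop c d f) - 2%:R *: Yop a b c d f.
Proof.
rewrite /Pop /Qop /Yop !linearB !linearD /= scaler_nat.
lmod_ring.
Qed.


Definition Qstable W := is_subspace W /\ forall a b f, W f -> W (Qop a b f).

(** By [Pop_Pop] only Y f has to be placed in W, and [Qop_Qop] says that modulo W it is
    antisymmetric, up to signs, in its last two indices. *)
Lemma Qstable_Pop_Pop W a b c d f : Qstable W -> W f -> W (Pop a b (Pop c d f)).
Proof.
move=> [sW QW] Wf; have YW a' b' c' d' :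
    W (Yop a' b' c' d' f + s c' d' *: Yop a' b' d' c' f).
  have -> : Yop a' b' c' d' f + s c' d' *: Yop a' b' d' c' f =
      Qop a' b' (Qop c' d' f) - kf c' d' *: Qop a' b' f.
    by rewrite Qop_Qop addrK.
  by apply: subspaceB => //; last (apply: subspaceZ => //); do ?apply: (QW).
(* The transpositions of (b, c) and (c, d) act on Y by + and - signs modulo W;
   by the braid relation Y and -Y agree modulo W. *)
have plus : W (Yop a b c d f + (s b c * s b d * s c d) *: Yop a d c b f).
  have := subspaceZ sW (s b c) (YW a c b d).
  rewrite scalerDr -YopC [Yop a c d b f]YopC !scalerA.
  by congr (W (_ + _ *: _)); ring.
have minus : W (Yop a b c d f - (s b c * s b d * s c d) *: Yop a d c b f).
  have := subspaceB sW (YW a b c d) (subspaceZ sW (s c d * s b d) (YW a d b c)).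
  rewrite [Yop a b d c f]YopC [(_ * _) *: (_ + _)]scalerDr !scalerA opprD addrA addrK.
  by congr (W (_ - _ *: _)); ring.
have Y2 : W (2%:R *: Yop a b c d f).
  have := subspaceD sW plus minus.
  by rewrite addrACA subrr addr0 scaler_nat mulr2n.
by rewrite Pop_Pop; apply: subspaceB => //; do 2!apply: (QW).
Qed.

Definition Pspan W : V -> Prop :=
  Defs.span (fun g => exists a b f, W f /\ g = Pop a b f).

Definition gl_stable W := is_subspace W /\ forall a b f, W f -> W (z a (w b f)).

Lemma Pspan_Pop W a b f : W f -> Pspan W (Pop a b f).
Proof. by move=> Wf; apply: span_gen; exists a, b, f. Qed.

Lemma Pop_Pspan W a b f : Qstable W -> Pspan W f -> W (Pop a b f).
Proof.
move=> qW; apply: (span_image (f := Pop a b)); first by case: qW.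
by move=> _ [c [d [g [Wg ->]]]]; apply: Qstable_Pop_Pop.
Qed.

Lemma Pspan_Qstable W : Qstable W -> Qstable (Pspan W).
Proof.
move=> [sW QW]; have sP : is_subspace (Pspan W) by apply: span_subspace.
split=> // a b f; apply: (span_image (f := Qop a b)) => //.
move=> _ [c [d [g [Wg ->]]]] /=; rewrite Qop_Pop.
have PW k a' b' h : W h -> Pspan W (k *: Pop a' b' h).
  by move=> Wh; apply: (subspaceZ sP); apply: Pspan_Pop.
apply: (subspaceB sP); last exact: PW.
by do ![apply: (subspaceD sP)]; apply: PW => //; apply: QW.
Qed.

Lemma zwE a b f : z a (w b f) = 2%:R^-1 *: (Qop a b f + Pop a b f).
Proof.
rewrite /Qop /Pop addrACA subrr addr0 -mulr2n -scaler_nat scalerA.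
by rewrite mulVf ?scale1r // pnatr_eq0.
Qed.

Lemma PQ_gl_stable W : Qstable W -> (forall a b f, W f -> W (Pop a b f)) ->
  gl_stable W.
Proof.
move=> [sW QW] PW; split=> // a b f Wf; rewrite zwE.
by apply: subspaceZ => //; apply: subspaceD => //; [apply: QW | apply: PW].
Qed.

(** The P's carry W into P W and, by [Pop_Pspan], P W back into W. So the intersection, and likewise
    the sum, is stable under the P's as well as the Q's, which together span the z w products. *)
Lemma gl_stable_cap W : Qstable W -> gl_stable (fun f => W f /\ Pspan W f).
Proof.
move=> qW; have [sW QW] := qW; have [sP QP] := Pspan_Qstable qW.
apply: PQ_gl_stable => [|a b f [Wf Pf]].
  split; last by move=> a b f [Wf Pf]; split; [apply: QW | apply: QP].
  split=> [|c f g [Wf Pf] [Wg Pg]]; first by split; apply: subspace0.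
  by split; [apply: sW.2 | apply: sP.2].
by split; [apply: Pop_Pspan | apply: Pspan_Pop].
Qed.

Lemma gl_stable_sum W : Qstable W ->
  gl_stable (fun f => exists g h, [/\ W g, Pspan W h & f = g + h]).
Proof.
move=> qW; have [sW QW] := qW; have [sP QP] := Pspan_Qstable qW.
apply: PQ_gl_stable => [|a b _ [g [h [Wg Ph ->]]]]; last first.
  exists (Pop a b h), (Pop a b g); rewrite linearD addrC.
  by split=> //; [apply: Pop_Pspan | apply: Pspan_Pop].
split=> [|a b _ [g [h [Wg Ph ->]]]]; last first.
  exists (Qop a b g), (Qop a b h); rewrite linearD.
  by split=> //; [apply: QW | apply: QP].
split=> [|c _ _ [g [h [Wg Ph ->]]] [g' [h' [Wg' Ph' ->]]]].
  by exists 0, 0; rewrite addr0; split=> //; apply: subspace0.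
exists (c *: g + g'), (c *: h + h'); split; [exact: sW.2 | exact: sP.2 |].
by rewrite scalerDr addrACA.
Qed.

End Howe.

(** * Monomials and weights *)

Section Monomials.
Variables (K : numFieldType) (m N : nat).
Local Notation A' := (superpoly K m N).
Implicit Types (f g : A') (S : {set 'I_m}) (al : 'X_{1..N}).
Implicit Types (u v : {set 'I_m} * 'X_{1..N}).

Definition bas u : A' := [ffun S => if S == u.1 then 'X_[u.2] else 0].

Lemma scoef_bas u v : scoef v (bas u) = (u == v)%:R.
Proof.
rewrite /scoef ffunE; case: u v => [X al] [Y al'] /=.
rewrite xpair_eqE (eq_sym X); case: eqP => _ /=; last by rewrite mcoeff0.
by rewrite mcoeffX.
Qed.

Lemma bas_neq0 u : bas u != 0.
Proof.
apply/eqP=> /(congr1 (scoef u)); rewrite scoef_bas eqxx scoef0.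
by move/eqP; rewrite oner_eq0.
Qed.

Lemma scoef_sum (J : Type) (r : seq J) (P : pred J) (F : J -> A') u :
  scoef u (\sum_(j <- r | P j) F j) = \sum_(j <- r | P j) scoef u (F j).
Proof. by apply: (big_morph (scoef u)); [apply: scoefD | apply: scoef0]. Qed.

Definition msupport f : seq ({set 'I_m} * 'X_{1..N}) :=
  [seq (X, al) | X <- enum {set 'I_m}, al <- msupp (f X)].

Lemma mem_msupport f u : (u \in msupport f) = (scoef u f != 0).
Proof.
rewrite /scoef -mcoeff_msupp; case: u => X al /=.
apply/allpairsPdep/idP => [[Y [al' [_ al'f [-> ->]]]] //|alf].
by exists X, al; rewrite mem_enum.
Qed.

Lemma msupport_uniq f : uniq (msupport f).
Proof.
apply: allpairs_uniq_dep => [|S _|]; rewrite ?enum_uniq ?msupp_uniq //.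
by move=> [X al] [Y al'] /= _ _ [-> ->].
Qed.

Lemma superpoly_sum f : f = \sum_(u <- msupport f) scoef u f *: bas u.
Proof.
apply: scoefP => v; rewrite scoef_sum.
under eq_bigr => u _ do rewrite scoefZ scoef_bas.
have [vf|] := boolP (v \in msupport f).
  rewrite (bigD1_seq v) ?msupport_uniq //= eqxx mulr1 big1 ?addr0 // => u uv.
  by rewrite (negPf uv) mulr0.
move=> vf; have := vf; rewrite mem_msupport negbK => /eqP->.
rewrite big_seq big1 // => u uf; case: eqP => [uv|]; last by rewrite mulr0.
by rewrite uv (negPf vf) in uf.
Qed.

Lemma superpoly_ind (U : A' -> Prop) f :
  is_subspace U -> (forall u, scoef u f != 0 -> U (bas u)) -> U f.
Proof.
move=> sU Uf; rewrite [f]superpoly_sum big_seq; apply: (subspace_sum sU) => u.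
by rewrite mem_msupport => /Uf; apply: (subspaceZ sU).
Qed.

(** [theta_sign] as a scalar of K, so that the generators send each basis vector to a multiple of a
    basis vector. *)
Definition nsign (p : 'I_m) S : K := (-1) ^+ #|[set q in S | (q < p)%N]|.

Lemma nsign_sqr p S : nsign p S * nsign p S = 1.
Proof. by rewrite -expr2 /nsign sqrr_sign. Qed.

Lemma nsign_neq0 p S : nsign p S != 0.
Proof. by rewrite /nsign signr_eq0. Qed.

Lemma theta_signE p S (r : {mpoly K[N]}) : theta_sign K N p S * r = nsign p S *: r.
Proof.
rewrite /theta_sign /nsign -signr_odd -[in RHS]signr_odd.
by rewrite mulr_sign scaler_sign.
Qed.

Lemma nsignU1 p S : nsign p (p |: S) = nsign p S.
Proof.
rewrite /nsign; congr (_ ^+ _); apply: eq_card => q; rewrite !inE.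
by case: eqVneq => [->|]; rewrite ?ltnn ?andbF.
Qed.

Lemma theta_bas p S al :
  theta p (bas (S, al)) = if p \in S then 0 else nsign p S *: bas (p |: S, al).
Proof.
case: ifP => pS; apply/ffunP=> S'; rewrite !ffunE /=.
  case: ifP => // pS'; case: eqP => [E|]; rewrite ?mulr0 //.
  by move: pS; rewrite -E !inE eqxx.
case: ifP => pS'; last first.
  by case: eqP => [E|]; rewrite ?scaler0 //; rewrite E setU11 in pS'.
rewrite theta_signE; case: (eqVneq S' (p |: S)) => [->|SS'].
  by rewrite setU1K ?pS // eqxx nsignU1.
case: eqP => [E|]; rewrite ?scaler0 //.
by rewrite -E setD1K ?eqxx in SS'.
Qed.

Lemma dtheta_bas p S al :
  dtheta p (bas (S, al)) = if p \in S then nsign p S *: bas (S :\ p, al) else 0.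
Proof.
case: ifP => pS; apply/ffunP=> S'; rewrite !ffunE /=; last first.
  case: ifP => // pS'; case: eqP => [E|]; rewrite ?mulr0 //.
  by move: pS; rewrite -E !inE eqxx.
case: ifP => pS'.
  by case: eqP => [E|]; rewrite ?scaler0 //; rewrite E !inE eqxx in pS'.
rewrite theta_signE; case: (eqVneq S' (S :\ p)) => [->|SS'].
  by rewrite setD1K // eqxx -(nsignU1 p (S :\ p)) setD1K.
case: eqP => [E|]; rewrite ?scaler0 //.
by rewrite -E setU1K ?pS' ?eqxx in SS'.
Qed.

Lemma xmul_bas i S al : xmul i (bas (S, al)) = bas (S, (U_(i) + al)%MM).
Proof.
apply/ffunP=> S'; rewrite !ffunE /=; case: eqP => _; last by rewrite mulr0.
by rewrite mpolyXD.
Qed.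

Lemma dx_bas i S al : dx i (bas (S, al)) = (al i)%:R *: bas (S, (al - U_(i))%MM).
Proof.
apply/ffunP=> S'; rewrite !ffunE /=; case: eqP => _; last by rewrite linear0 scaler0.
by rewrite mderivX.
Qed.

(** Sorting the thetas contributes signs and a repeated theta gives 0; both effects are absorbed in
    c. *)
Lemma supermonoE al (s : seq 'I_m) :
  exists2 c, supermono K al s = c *: bas ([set p in s], al) & (c != 0) = uniq s.
Proof.
elim: s => [|p s [c Ec Eu]].
  exists 1; last by rewrite oner_eq0.
  rewrite scale1r; apply/ffunP=> S; rewrite !ffunE /=.
  by congr (if S == _ then _ else _); apply/setP=> q; rewrite !inE.
rewrite /supermono /= -/(supermono K al s) Ec linearZ /= theta_bas.
rewrite inE; have [ps|ps] := boolP (p \in s).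
  by exists 0; rewrite ?eqxx ?ps // scaler0 scale0r.
exists (c * nsign p [set q in s]); last first.
  by rewrite mulf_eq0 negb_or nsign_neq0 andbT Eu /=.
rewrite scalerA; congr (_ *: bas (_, _)).
by apply/setP=> q; rewrite !inE.
Qed.

End Monomials.

(** * Connectedness of the monomial basis under gl *)

Section GlIrreducible.
Variables (K : numFieldType) (m1 n : nat).
Local Notation m := (m1 + m1)%N.
Local Notation N := (n + n)%N.
Local Notation A' := (superpoly K m N).
Local Notation I := 'I_(m + N).
Variable T : {set 'I_N}.
Implicit Types (a b c d : I) (f g : A').
Local Notation index := ({set 'I_m} * 'X_{1..N})%type.
Implicit Types (u v : index).
Local Notation z := (@zop K m1 n T).
Local Notation d := (@dop K m1 n T).
Local Notation bas := (@bas K m N).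

(* The number of times z_a has been applied, signed so that every z_a raises
   and every d_a lowers it. *)
Definition gam u a : int :=
  match split a with
  | inl p => (p \in u.1)%:Z
  | inr i => if i \in T then - (u.2 i)%:Z else (u.2 i)%:Z
  end.

Lemma gam_inj u v : gam u =1 gam v -> u = v.
Proof.
case: u v => [X al] [Y al'] E; congr (_, _).
  by apply/setP=> p; have := E (lshift N p); rewrite /gam splitE /=; lia.
apply/mnmP=> i; have := E (rshift m i); rewrite /gam splitE /=.
by case: ifP => _; lia.
Qed.

Lemma zop_bas a u :
  (exists k v, [/\ z a (bas u) = k *: bas v, k != 0 &
     forall b, gam v b = gam u b + (b == a)%:Z]) \/
  z a (bas u) = 0 /\ forall v, gam v a <= gam u a.
Proof.
case: u => X al; case: (split_ordP a) => [p|i] ->.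
  rewrite zop_lshift theta_bas; case: ifP => pX; [right|left].
    by split=> // v; rewrite /gam splitE /= pX; case: (p \in v.1).
  exists (nsign K p X), (p |: X, al); split=> // [|b]; first exact: nsign_neq0.
  rewrite /gam; case: (split_ordP b) => [q|j] ->; last by rewrite eq_rlshift addr0.
  rewrite /= in_setU1 (inj_eq (@lshift_inj _ _)).
  by case: eqP => [->|_] /=; rewrite ?pX ?addr0 ?add0r.
rewrite zop_rshift; case: ifP => iT; last first.
  left; exists 1, (X, (U_(i) + al)%MM); rewrite xmul_bas scale1r oner_eq0.
  split=> // b; rewrite /gam; case: (split_ordP b) => [q|j] ->.
    by rewrite eq_lrshift addr0.
  rewrite /= mnmDE mnm1E (inj_eq (@rshift_inj _ _)) eq_sym.
  by case: eqP => [->|_]; [rewrite iT /=; lia | case: ifP => _ /=; lia].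
rewrite dx_bas; case: (posnP (al i)) => al0; [right|left].
  by rewrite al0 scale0r; split=> // v; rewrite /gam splitE iT /= al0; lia.
exists (al i)%:R, (X, (al - U_(i))%MM); rewrite pnatr_eq0 -lt0n al0.
split=> // b; rewrite /gam; case: (split_ordP b) => [q|j] ->.
  by rewrite eq_lrshift addr0.
rewrite /= mnmBE mnm1E (inj_eq (@rshift_inj _ _)) eq_sym.
by case: eqP => [->|_]; [rewrite iT /=; lia | case: ifP => _ /=; lia].
Qed.

Lemma dop_bas a u :
  (exists k v, [/\ d a (bas u) = k *: bas v, k != 0 &
     forall b, gam v b = gam u b - (b == a)%:Z]) \/
  d a (bas u) = 0 /\ forall v, gam u a <= gam v a.
Proof.
case: u => X al; case: (split_ordP a) => [p|i] ->.
  rewrite dop_lshift dtheta_bas; case: ifP => pX; [left|right]; last first.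
    by split=> // v; rewrite /gam splitE /= pX; case: (p \in v.1).
  exists (nsign K p X), (X :\ p, al); split=> // [|b]; first exact: nsign_neq0.
  rewrite /gam; case: (split_ordP b) => [q|j] ->; last by rewrite eq_rlshift subr0.
  rewrite /= in_setD1 (inj_eq (@lshift_inj _ _)).
  by case: eqP => [->|_] /=; rewrite ?pX ?subr0 ?subrr.
rewrite dop_rshift; case: ifP => iT.
  left; exists (-1), (X, (U_(i) + al)%MM); rewrite xmul_bas scaleN1r oppr_eq0 oner_eq0.
  split=> // b; rewrite /gam; case: (split_ordP b) => [q|j] ->.
    by rewrite eq_lrshift subr0.
  rewrite /= mnmDE mnm1E (inj_eq (@rshift_inj _ _)) eq_sym.
  by case: eqP => [->|_]; [rewrite iT /=; lia | case: ifP => _ /=; lia].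
rewrite dx_bas; case: (posnP (al i)) => al0; [right|left].
  by rewrite al0 scale0r; split=> // v; rewrite /gam splitE iT /= al0; lia.
exists (al i)%:R, (X, (al - U_(i))%MM); rewrite pnatr_eq0 -lt0n al0.
split=> // b; rewrite /gam; case: (split_ordP b) => [q|j] ->.
  by rewrite eq_lrshift subr0.
rewrite /= mnmBE mnm1E (inj_eq (@rshift_inj _ _)) eq_sym.
by case: eqP => [->|_]; [rewrite iT /=; lia | case: ifP => _ /=; lia].
Qed.

(** The eigenvalue of z_a d_a. For an index in T this operator is - (d/dx) x = - x d/dx - 1, whence
    the shift. *)
Definition lam u a : int := gam u a - (if split a is inr i then i \in T else false)%:Z.

Lemma zd_bas a u : z a (d a (bas u)) = (lam u a)%:~R *: bas u.
Proof.
rewrite /lam /gam; case: u => X al; case: (split_ordP a) => [p|i] E; rewrite E.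
  rewrite zop_lshift dop_lshift dtheta_bas; case: ifP => pX; last first.
    by rewrite linear0 subr0 scale0r.
  rewrite linearZ /= theta_bas !inE eqxx /= scalerA setD1K // subr0.
  by rewrite -[nsign K p (X :\ p)]nsignU1 setD1K // nsign_sqr.
rewrite zop_rshift dop_rshift /=; case: (i \in T).
  rewrite xmul_bas dxN dx_bas mnmDE mnm1E eqxx addmC addmK -scaleNr.
  by congr (_ *: _); rewrite addnC natrD -opprD rmorphN rmorphD.
rewrite dx_bas linearZ /= xmul_bas subr0.
case: (posnP (al i)) => al0; first by rewrite al0 !scale0r.
congr (_ *: bas (_, _)); rewrite addmC submK //.
by apply/mnm_lepP=> j; rewrite mnm1E; case: eqP => // <-.
Qed.

Lemma scoef_zd a u f : scoef u (z a (d a f)) = (lam u a)%:~R * scoef u f.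
Proof.
apply: (superpoly_ind (U := fun f => scoef u (z a (d a f)) = (lam u a)%:~R * scoef u f)).
  split=> [|k g h Eg Eh]; first by rewrite !linear0 scoef0 mulr0.
  by rewrite !linearP /= !scoefD !scoefZ Eg Eh; ring.
move=> v _; rewrite zd_bas scoefZ scoef_bas; case: eqP => [->//|_].
by rewrite !mulr0.
Qed.

Definition charge u : int := \sum_a gam u a.

Lemma chargeE u :
  charge u = #|u.1|%:Z
    + ((\sum_(i in ~: T) u.2 i)%N%:Z - (\sum_(i in T) u.2 i)%N%:Z).
Proof.
rewrite /charge big_split_ord /=; congr (_ + _).
  under eq_bigr => p _ do rewrite /gam splitE.
  rewrite -(big_morph _ PoszD (erefl 0%:Z)) -sum1_card [in RHS]big_mkcond /=.
  by congr (Posz _); apply: eq_bigr => p _; case: (p \in u.1).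
under eq_bigr => i _ do rewrite /gam splitE.
rewrite (bigID (mem T)) /= addrC !(big_morph _ PoszD (erefl 0%:Z)); congr (_ + _).
  by apply: eq_big => [i|i /negPf ->]; rewrite ?inE.
by rewrite -sumrN; apply: eq_bigr => i ->.
Qed.


(** A'_k described through coordinates; [AprimeE] shows the agreement. *)
Definition Vcharge (k : int) f : Prop := forall u, scoef u f != 0 -> charge u = k.

Lemma Vcharge_subspace k : is_subspace (Vcharge k).
Proof.
split=> [u|c f g Vf Vg u]; first by rewrite scoef0 eqxx.
rewrite scoefD scoefZ; case: (eqVneq (scoef u f) 0) => [->|/Vf//].
by rewrite mulr0 add0r; apply: Vg.
Qed.

Lemma Vcharge_bas k u : charge u = k -> Vcharge k (bas u).
Proof. by move=> uk v; rewrite scoef_bas; case: (eqVneq u v) => [<-//|_]; rewrite eqxx. Qed.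

Lemma sum_delta a : (\sum_b (b == a) = 1)%N.
Proof. by rewrite (bigD1 a) //= eqxx big1 // => b /negPf->. Qed.

Lemma Vcharge_zd k a b f : Vcharge k f -> Vcharge k (z a (d b f)).
Proof.
move=> Vf; have sV := Vcharge_subspace k.
apply: (superpoly_ind (U := fun f => Vcharge k (z a (d b f)))) => [|u /Vf uk].
  split=> [|c g h Vg Vh]; first by rewrite !linear0; apply: subspace0.
  by rewrite !linearP; apply: sV.2.
case: (dop_bas b u) => [[c [v [-> _ Ev]]]|[-> _]]; last first.
  by rewrite linear0; apply: subspace0.
rewrite linearZ /=; apply: (subspaceZ sV).
case: (zop_bas a v) => [[c' [v' [-> _ Ev']]]|[-> _]]; last exact: subspace0.
apply: (subspaceZ sV); apply: Vcharge_bas; rewrite -uk /charge.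
under eq_bigr => e _ do rewrite Ev' Ev.
rewrite big_split sumrB /= -!(big_morph _ PoszD (erefl 0%:Z)) !sum_delta.
by rewrite subrK.
Qed.

(** The z_a d_a are simultaneously diagonal with joint eigenvalues separating the basis ([gam_inj]),
    so the support of a vector of M can be shrunk to a single monomial. *)
Lemma exists_bas (M : A' -> Prop) f : is_subspace M ->
  (forall a g, M g -> M (z a (d a g))) -> M f -> f != 0 ->
  exists2 u, scoef u f != 0 & M (bas u).
Proof.
move=> sM dM.
have [k] := ubnP (size (msupport f)); elim: k f => // k IH f sf Mf f0.
have [u uf] : exists u, u \in msupport f.
  case E: (msupport f) => [|u r]; last by exists u; rewrite mem_head.
  by move: f0; rewrite [f]superpoly_sum E big_nil eqxx.
have fu0 : scoef u f != 0 by rewrite -mem_msupport.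
have [/hasP[v vf /= vu]|/hasPn only] := boolP (has (predC1 u) (msupport f)); last first.
  exists u => //; apply: (subspaceZK sM fu0).
  suff -> : scoef u f *: bas u = f by [].
  apply: scoefP => v; rewrite scoefZ scoef_bas.
  case: eqP => [->|/eqP uv]; first by rewrite mulr1.
  rewrite mulr0; apply/esym/eqP; rewrite -[_ == 0]negbK -mem_msupport.
  by apply/negP=> /only /=; rewrite eq_sym (negPf uv).
have [a ua] : exists a, gam v a != gam u a.
  case: (pickP (fun a => gam v a != gam u a)) => [a|E]; first by exists a.
  by case/eqP: vu; apply: gam_inj => a; apply/eqP/negPn; rewrite E.
(* This removes u from the support, keeps v, and adds nothing new. *)
pose g := z a (d a f) - (lam u a)%:~R *: f.
have gE w : scoef w g = (gam w a - gam u a)%:~R * scoef w f.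
  rewrite scoefD scoefN scoefZ scoef_zd -mulrBl -rmorphB; congr (_%:~R * _).
  by rewrite /lam; lia.
have [|||w wg Mw] := IH g.
- have sg : {subset msupport g <= rem u (msupport f)}.
    move=> w; rewrite mem_rem_uniq ?msupport_uniq // inE /= !mem_msupport gE.
    rewrite mulf_eq0 negb_or => /andP[wu ->]; rewrite andbT.
    by apply: contraNneq wu => ->; rewrite subrr.
  have := uniq_leq_size (msupport_uniq g) sg; rewrite size_rem //.
  case: (msupport f) uf sf => //= x r _; rewrite ltnS => sf sg'.
  exact: leq_ltn_trans sg' _.
- by apply: (subspaceB sM); [apply: dM | apply: (subspaceZ sM)].
- apply/eqP=> g0; have := gE v; rewrite g0 scoef0 => /esym/eqP.
  by rewrite mulf_eq0 intr_eq0 subr_eq0 (negPf ua) -[_ == 0]negbK -mem_msupport vf.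
by exists w => //; move: wg; rewrite gE mulf_eq0 negb_or => /andP[].
Qed.

Lemma dist_step u v :
  charge u = charge v -> u != v ->
  exists a b, gam u a < gam v a /\ gam v b < gam u b.
Proof.
move=> uv; case: eqP => // nuv _.
have strict (x y : index) : charge x = charge y -> x <> y -> exists a, gam x a < gam y a.
  move=> xy nxy; case: (pickP (fun a => gam x a < gam y a)) => [a xa|le].
    by exists a.
  case: nxy; apply: gam_inj => a; apply/eqP; rewrite -subr_eq0.
  (* If no coordinate of x were smaller than that of y, the differences would be nonnegative with
     sum 0, hence all 0. *)
  have := @psumr_eq0P _ _ xpredT (fun a => gam x a - gam y a).
  move=> -> //.
    by move=> b _; rewrite subr_ge0 leNgt le.
  by rewrite sumrB; apply/eqP; rewrite subr_eq0; apply/eqP.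
have [a ?] := strict _ _ uv nuv.
have [b ?] := strict _ _ (esym uv) (fun e => nuv (esym e)).
by exists a, b.
Qed.

(** Induction on the l1-distance of the weights: z_a d_b moves u towards v when a is too small and b
    too large in u, as provided by [dist_step]. *)
Lemma bas_connect (M : A' -> Prop) u v : is_subspace M ->
  (forall a b g, M g -> M (z a (d b g))) -> charge u = charge v ->
  M (bas u) -> M (bas v).
Proof.
move=> sM gM.
have [k] := ubnP (\sum_c `|gam u c - gam v c|)%N; elim: k u => // k IH u.
move=> dk uv Mu; have [<-//|nuv] := eqVneq u v.
have [a [b [ua ub]]] := dist_step uv nuv.
(* If d_b killed u, its b-coordinate would be minimal, but that of v is smaller. The same argument,
   with v larger at a, applies to z_a below. *)
have [[c [x [Ex c0 gx]]]|[_ /(_ v)]] := dop_bas b u; last lia.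
have xa : gam x a = gam u a.
  by rewrite gx; case: eqP => [ab|_]; [rewrite ab in ua; lia | rewrite subr0].
have [[c' [y [Ey c'0 gy]]]|[_ /(_ v)]] := zop_bas a x; last by lia.
have gyE e : gam y e = gam u e - (e == b)%:Z + (e == a)%:Z by rewrite gy gx.
apply: (IH y).
- rewrite -ltnS; apply: leq_trans dk; rewrite ltnS.
  rewrite (bigD1 a) //= [in X in (_ < X)%N](bigD1 a) //= -addSn leq_add //.
    by rewrite gyE eqxx; case: eqP => [ab|_]; [rewrite ab in ua; lia | lia].
  apply: leq_sum => e ea; rewrite gyE (negPf ea).
  by case: eqP => [->|_]; lia.
- rewrite -uv /charge; under eq_bigr => e _ do rewrite gyE.
  rewrite big_split sumrB /= -!(big_morph _ PoszD (erefl 0%:Z)) !sum_delta.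
  by rewrite subrK.
apply: (subspaceZK sM (c := c * c')); first by rewrite mulf_neq0.
by rewrite -scalerA -Ey -linearZ /= -Ex; apply: gM.
Qed.


End GlIrreducible.
Arguments Vcharge_subspace {K m1 n} T k.

(** * The action of osp *)

Section OspAction.
Variables (K : numFieldType) (m1 n : nat).
Local Notation m := (m1 + m1)%N.
Local Notation N := (n + n)%N.
Local Notation A' := (superpoly K m N).
Local Notation I := 'I_(m + N).
Variable T : {set 'I_N}.
Implicit Types (a b c d : I) (f g : A') (W : A' -> Prop) (X : 'M[K]_(m + N)).
Local Notation s := (@ksign K m1 n).
Local Notation kf := (@kform K m1 n).
Local Notation eps := (@dual_sign K m1 n).
Local Notation d := (@dop K m1 n T).

Definition zlin a : {linear A' -> A'} := zop T a.
Definition wlin a : {linear A' -> A'} := wop T a.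
Local Notation z := zlin.
Local Notation w := wlin.
Local Notation Q := (Qop z w).

(** The signs of the involution of gl whose fixed space is osp ([ospP]). *)
Definition tau a b : K := eps a * eps (star b) * s a b.

Lemma tau_sqr a b : tau a b * tau a b = 1.
Proof.
by rewrite /tau mulrACA ksign_sqr mulr1 mulrACA !eps_sqr mulr1.
Qed.

Lemma tau_star a b : tau (star b) (star a) = tau a b.
Proof.
by rewrite /tau starK ksign_starl ksignC ksign_starl [eps (star b) * _]mulrC.
Qed.

Lemma zopZ a k f : zop T a (k *: f) = k *: zop T a f.
Proof. exact: linearZ. Qed.

Lemma dwop b f : d b f = eps (star b) *: wop T (star b) f.
Proof. by rewrite wopE starK scalerA eps_sqr scale1r. Qed.

(** Moving z past w in the second half of Q produces the mirror matrix unit and the constant [kf];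
    so the osp-invariant combination of two matrix units acts as a Q up to sign and a scalar. *)
Lemma E_act_tau a b f :
  E_act T a b f + tau a b *: E_act T (star b) (star a) f =
  eps (star b) *: (Q a (star b) f - kf a (star b) *: f).
Proof.
have -> : Q a (star b) f - kf a (star b) *: f =
    zop T a (wop T (star b) f) + s a b *: zop T (star b) (wop T a f).
  rewrite /Qop (wop_zop T a (star b) f : w a _ = _) addrA addrK.
  by rewrite [s a _]ksignC ksign_starl ksignC.
rewrite !E_actE !dwop starK !zopZ scalerDr !scalerA; congr (_ + _ *: _).
have := eps_sqr K a; rewrite /tau; move: (eps a) => e He.
by rewrite -[RHS]mul1r -He; ring.
Qed.

Variant index_spec : I -> Type :=
  | IndexF1 i : index_spec (f1 n i)
  | IndexF2 i : index_spec (f2 n i)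
  | IndexB1 j : index_spec (b1 m1 j)
  | IndexB2 j : index_spec (b2 m1 j).

Lemma indexP a : index_spec a.
Proof.
by case: (split_ordP a) => i ->; case: (split_ordP i) => j ->; constructor.
Qed.

Lemma star_f1 i : star (f1 n i) = f2 n i :> I.
Proof. by rewrite /star /f1 /swap_half !splitE. Qed.
Lemma star_f2 i : star (f2 n i) = f1 n i :> I.
Proof. by rewrite /star /f2 /swap_half !splitE. Qed.
Lemma star_b1 j : star (b1 m1 j) = b2 m1 j :> I.
Proof. by rewrite /star /b1 /swap_half !splitE. Qed.
Lemma star_b2 j : star (b2 m1 j) = b1 m1 j :> I.
Proof. by rewrite /star /b2 /swap_half !splitE. Qed.
Definition starE := (star_f1, star_f2, star_b1, star_b2).

Lemma eps_f1 i : eps (f1 n i) = 1.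
Proof. by rewrite /dual_sign /in_b2 /f1 !splitE. Qed.
Lemma eps_f2 i : eps (f2 n i) = 1.
Proof. by rewrite /dual_sign /in_b2 /f2 !splitE. Qed.
Lemma eps_b1 j : eps (b1 m1 j) = 1.
Proof. by rewrite /dual_sign /in_b2 /b1 !splitE. Qed.
Lemma eps_b2 j : eps (b2 m1 j) = -1.
Proof. by rewrite /dual_sign /in_b2 /b2 !splitE. Qed.
Definition epsE := (eps_f1, eps_f2, eps_b1, eps_b2).

Lemma fermi_f1 i : fermi (f1 n i : I). Proof. by rewrite /fermi /f1 splitE. Qed.
Lemma fermi_f2 i : fermi (f2 n i : I). Proof. by rewrite /fermi /f2 splitE. Qed.
Lemma fermi_b1 j : fermi (b1 m1 j : I) = false.
Proof. by rewrite /fermi /b1 splitE. Qed.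
Lemma fermi_b2 j : fermi (b2 m1 j : I) = false.
Proof. by rewrite /fermi /b2 splitE. Qed.
Definition fermiE := (fermi_f1, fermi_f2, fermi_b1, fermi_b2).

Lemma ospP X : osp X <-> forall a b, X (star b) (star a) = tau a b * X a b.
Proof.
split=> [[A [B [C [D [E [F [H [H1 [L [L1 [hB hC hE hF ->]]]]]]]]]]] a b|sX].
  have B' i j : B i j = - B j i by rewrite {1}hB !mxE.
  have C' i j : C i j = - C j i by rewrite {1}hC !mxE.
  have E' i j : E i j = E j i by rewrite {1}hE !mxE.
  have F' i j : F i j = F j i by rewrite {1}hF !mxE.
  case: (indexP a) => i; case: (indexP b) => j;
  rewrite !starE /tau !starE !epsE /ksign !fermiE /= ?expr0 ?expr1 /f1 /f2 /b1 /b2;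
  rewrite ?(block_mxEul, block_mxEur, block_mxEdl, block_mxEdr) ?mxE;
  by first [ring | rewrite (B' j i); ring | rewrite (C' j i); ring
           | rewrite (E' j i); ring | rewrite (F' j i); ring].
exists (\matrix_(i, j) X (f1 n i) (f1 n j)), (\matrix_(i, j) X (f1 n i) (f2 n j)),
  (\matrix_(i, j) X (f2 n i) (f1 n j)), (\matrix_(i, j) X (b1 m1 i) (b1 m1 j)),
  (\matrix_(i, j) X (b1 m1 i) (b2 m1 j)), (\matrix_(i, j) X (b2 m1 i) (b1 m1 j)),
  (\matrix_(i, j) X (f1 n i) (b1 m1 j)), (\matrix_(i, j) X (f1 n i) (b2 m1 j)),
  (\matrix_(i, j) X (f2 n i) (b1 m1 j)), (\matrix_(i, j) X (f2 n i) (b2 m1 j)).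
have sX' a b : X a b = tau a b * X (star b) (star a).
  by rewrite sX mulrA tau_sqr mul1r.
have tauE := (starE, epsE, fermiE).
split; do ?[apply/matrixP=> i j; rewrite !mxE sX' /tau !tauE /ksign !tauE /=; ring].
apply/matrixP=> a b; case: (indexP a) => i; case: (indexP b) => j;
rewrite /f1 /f2 /b1 /b2 ?(block_mxEul, block_mxEur, block_mxEdl, block_mxEdr) ?mxE //;
rewrite -/(f1 n i) -/(f2 n i) -/(b1 m1 i) -/(b2 m1 i) sX' /tau !tauE /ksign !tauE;
by rewrite /=; ring.
Qed.

Lemma actD X Y f : act T (X + Y) f = act T X f + act T Y f.
Proof.
rewrite /act -big_split; apply: eq_bigr => a _; rewrite -big_split.
by apply: eq_bigr => b _; rewrite mxE scalerDl.
Qed.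

Lemma actZ k X f : act T (k *: X) f = k *: act T X f.
Proof.
rewrite /act scaler_sumr; apply: eq_bigr => a _; rewrite scaler_sumr.
by apply: eq_bigr => b _; rewrite mxE scalerA.
Qed.

Lemma act_delta a b f : act T (delta_mx a b) f = E_act T a b f.
Proof.
rewrite /act (bigD1 a) //= [X in _ + X]big1 => [|c /negPf ca]; last first.
  by rewrite big1 // => e _; rewrite mxE ca scale0r.
rewrite addr0 (bigD1 b) //= big1 => [|e /negPf eb]; last first.
  by rewrite mxE eb andbF scale0r.
by rewrite mxE !eqxx scale1r addr0.
Qed.

Lemma act_osp X f : osp X ->
  2%:R *: act T X f =
  \sum_a \sum_b (X a b * eps (star b)) *: (Q a (star b) f - kf a (star b) *: f).
Proof.
move=> /ospP sX; rewrite scaler_nat mulr2n {2}/act.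
(* One of the two copies of the sum is reindexed by duality and transposed, pairing each entry with
   its mirror entry as in [E_act_tau]. *)
rewrite (reindex_inj (inv_inj (@starK m1 n))) exchange_big /=.
rewrite (reindex_inj (inv_inj (@starK m1 n))) -big_split; apply: eq_bigr => a _.
rewrite -big_split; apply: eq_bigr => b _.
by rewrite sX -scalerA -E_act_tau scalerDr scalerA [tau a b * _]mulrC.
Qed.

Lemma osp_delta a b :
  osp (delta_mx a b + tau a b *: delta_mx (star b) (star a)).
Proof.
apply/ospP=> c e; rewrite !mxE.
rewrite !(inj_eq (inv_inj (@starK m1 n))) !(inv_eq (@starK m1 n)).
rewrite mulrDr mulrCA addrC; congr (_ + _).
  case: (eqVneq c a) => [->|_]; rewrite ?andbF ?mulr0 //.
  by case: (eqVneq e b) => [->|_]; rewrite ?mulr0 ?mulr1.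
case: (eqVneq e (star a)) => [->|_]; rewrite ?andbF ?mulr0 //.
case: (eqVneq c (star b)) => [->|_]; rewrite ?mulr0 //.
by rewrite mulr1 tau_star tau_sqr.
Qed.

(** The scalars separating Q's from elements of osp are harmless, W being a subspace. This transfers
    the abstract results on Q-stable subspaces to osp-submodules. *)
Lemma submoduleP W : is_submodule T W <-> Qstable z w W.
Proof.
split=> [[sW aW]|[sW QW]].
  split=> // a b f Wf; have := aW _ _ (osp_delta a (star b)) Wf.
  rewrite actD actZ !act_delta E_act_tau starK => WQ.
  rewrite -[Q a b f](subrK (kf a b *: f)); apply: (subspaceD sW).
    by apply: (subspaceZK sW) WQ; rewrite /dual_sign signr_eq0.
  exact: (subspaceZ sW).
split=> // X f oX Wf; apply: (subspaceZK sW (c := 2%:R)); first by rewrite pnatr_eq0.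
rewrite act_osp //; do 2![apply: (subspace_sum sW) => ? _].
apply: (subspaceZ sW); apply: (subspaceB sW); first exact: QW.
exact: (subspaceZ sW).
Qed.

Lemma gl_stable_zd W a b f : gl_stable z w W -> W f -> W (zop T a (d b f)).
Proof.
move=> [sW zwW] Wf; rewrite dwop zopZ; apply: (subspaceZ sW); exact: zwW.
Qed.

Lemma Vcharge_gl_stable k : gl_stable z w (Vcharge T k).
Proof.
split=> [|a b f Vf]; first exact: Vcharge_subspace.
rewrite /= wopE zopZ; apply: (subspaceZ (Vcharge_subspace T k)).
exact: Vcharge_zd.
Qed.

(** W contains a monomial by [exists_bas], then every monomial of the same charge by
    [bas_connect]. *)
Lemma Vcharge_gl_irreducible k W f : gl_stable z w W ->
  (forall g, W g -> Vcharge T k g) -> W f -> f != 0 ->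
  forall g, Vcharge T k g -> W g.
Proof.
move=> gW WV Wf f0 g Vg; have sW := gW.1.
have zdW a b h : W h -> W (zop T a (d b h)) by apply: gl_stable_zd.
have [|u uf Wu] := @exists_bas K m1 n T W f sW _ Wf f0; first by move=> a h; apply: zdW.
apply: superpoly_ind => // v vg; apply: (bas_connect sW zdW _ Wu).
by rewrite (WV _ Wf) // Vg.
Qed.

Lemma gl_stable_Pop W a b f : gl_stable z w W -> W f -> W (Pop z w a b f).
Proof.
move=> [sW zwW] Wf; apply: (subspaceB sW); first exact: zwW.
have -> : w a (z b f) = s a b *: z b (w a f) + kf a b *: f by apply: wop_zop.
by apply: (subspaceD sW); apply: (subspaceZ sW) => //; apply: zwW.
Qed.

Lemma gl_stable_Qop W a b f : gl_stable z w W -> W f -> W (Q a b f).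
Proof.
move=> [sW zwW] Wf; apply: (subspaceD sW); first exact: zwW.
have -> : w a (z b f) = s a b *: z b (w a f) + kf a b *: f by apply: wop_zop.
by apply: (subspaceD sW); apply: (subspaceZ sW) => //; apply: zwW.
Qed.

Lemma AprimeE k f : Aprime K m1 T k f <-> Vcharge T k%:Z f.
Proof.
split=> [|Vf].
  apply; first exact: Vcharge_subspace.
  move=> _ [al [q [_ E ->]]]; have [c -> cq] := supermonoE K al q.
  (* A repeated theta makes the size of the sequence exceed the number of distinct thetas, but then
     the monomial is 0. *)
  have [->|c0] := eqVneq c 0.
    by rewrite scale0r; apply: subspace0 (Vcharge_subspace _ _).
  apply: (subspaceZ (Vcharge_subspace _ _)); apply: Vcharge_bas; rewrite chargeE /= E.
  by rewrite cardsE (card_uniqP _) -?cq // addrC subrK.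
apply: superpoly_ind => [|[Y al] /Vf E]; first exact: span_subspace.
have [c Ec cq] := supermonoE K al (enum Y).
have c0 : c != 0 by rewrite cq enum_uniq.
apply: (subspaceZK (span_subspace _) c0).
apply: span_gen; exists al, (enum Y); split.
- by rewrite -cardE -[X in (_ <= X)%N]card_ord max_card.
- by move: E; rewrite chargeE -cardE /= => <-; rewrite [_%:Z + (_ - _)]addrC addrK.
by rewrite Ec; congr (_ *: bas _ (_, _)); apply/setP=> p; rewrite inE mem_enum.
Qed.

End OspAction.
Arguments Vcharge_gl_stable {K m1 n} T k.

(** * Irreducibility *)

Section Irreducibility.
Variables (K : numFieldType) (m1 n : nat).
Local Notation m := (m1 + m1)%N.
Local Notation N := (n + n)%N.
Local Notation A' := (superpoly K m N).
Local Notation I := 'I_(m + N).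
Variable T : {set 'I_N}.
Implicit Types (a b : I) (f g : A') (W : A' -> Prop).
Local Notation s := (@ksign K m1 n).
Local Notation kf := (@kform K m1 n).
Local Notation eps := (@dual_sign K m1 n).
Local Notation z := (@zlin K m1 n T).
Local Notation w := (@wlin K m1 n T).
Local Notation Q := (Qop z w).
Local Notation P := (Pop z w).
Local Notation V k := (Vcharge T k).
Local Notation charge := (@charge m1 n T).

Lemma Pspan_Vcharge k W f :
  (forall g, W g -> V k g) -> Pspan z w W f -> V k f.
Proof.
move=> WV; apply; first exact: Vcharge_subspace.
by move=> _ [a [b [g [/WV Vg ->]]]]; exact: (gl_stable_Pop _ _ (Vcharge_gl_stable _ k)).
Qed.

Let zzC a b f : z a (z b f) = s a b *: z b (z a f). Proof. exact: zopC. Qed.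
Let wwC a b f : w a (w b f) = s a b *: w b (w a f). Proof. exact: wopC. Qed.
Let wzC a b f : w a (z b f) = s a b *: z b (w a f) + kf a b *: f.
Proof. exact: wop_zop. Qed.
Let zwC a b f : z a (w b f) = s a b *: w b (z a f) + kf a b *: f.
Proof. exact: zop_wop. Qed.
Let xD u (f g : A') : scoef u (f + g) = scoef u f + scoef u g.
Proof. exact: scoefD. Qed.
Let xZ u (k : K) (f : A') : scoef u (k *: f) = k * scoef u f.
Proof. exact: scoefZ. Qed.
Let xP (f g : A') : (forall u, scoef u f = scoef u g) -> f = g.
Proof. exact: scoefP. Qed.

Lemma submodule_cap k W f : Qstable z w W -> (forall g, W g -> V k g) ->
  ~ (forall g, V k g -> W g) -> W f -> Pspan z w W f -> f = 0.
Proof.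
move=> qW WV nVW Wf Pf; have [//|f0] := eqVneq f 0; case: nVW => g Vg.
have gs := gl_stable_cap zzC wwC wzC zwC xD xZ xP qW.
by have [] := Vcharge_gl_irreducible gs (fun h Wh => WV h Wh.1) (conj Wf Pf) f0 Vg.
Qed.

Lemma submodule_sum k W f : Qstable z w W -> (forall g, W g -> V k g) ->
  W f -> f != 0 ->
  forall g, V k g -> exists g1 g2, [/\ W g1, Pspan z w W g2 & g = g1 + g2].
Proof.
move=> qW WV Wf f0; have gs := gl_stable_sum zzC wwC wzC zwC xD xZ xP qW.
apply: (Vcharge_gl_irreducible gs _ _ f0).
  move=> _ [g1 [g2 [/WV V1 /(Pspan_Vcharge WV) V2 ->]]].
  exact: subspaceD (Vcharge_subspace T k) _ _ V1 V2.
exists f, 0; split; rewrite ?addr0 //; apply: subspace0; exact: span_subspace.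
Qed.

Lemma scoef_Pdiag a u f :
  scoef u (P a (star a) f) =
  (eps (star a) * (lam T u a)%:~R
     - eps a * (s a a * (lam T u (star a))%:~R + 1)) * scoef u f.
Proof.
rewrite /Pop scoefD scoefN.
have -> : z a (w (star a) f) = eps (star a) *: zop T a (dop T a f).
  by rewrite /= wopE starK zopZ.
have -> : w a (z (star a) f) =
    eps a *: (s a a *: zop T (star a) (dop T (star a) f) + f).
  rewrite /= wopE dop_zop eqxx scale1r ksign_starl ksignC ksign_starl.
  by [].
by rewrite !(scoefZ, scoefD, scoef_zd); ring.
Qed.

(** If T is everything, the bosonic variables only lower the charge and the thetas raise it to at
    most m, so A'_k = 0 beyond m. Otherwise powers of one variable outside T reach every k. *)
Lemma exists_charge (k : nat) :
  (T = [set: 'I_N] -> (k <= m)%N) -> exists u, charge u = k.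
Proof.
move=> kT; have [TT|] := eqVneq T setT.
  exists ([set widen_ord (kT TT) p | p : 'I_k], 0%MM); rewrite chargeE /=.
  rewrite card_imset ?card_ord; last by move=> p q /(congr1 val) /= /val_inj.
  by rewrite !big1 ?subrr ?addr0 // => i _; rewrite mnm0E.
rewrite -subTset => /subsetPn[i _ iT].
exists (set0, (U_(i) *+ k)%MM); rewrite chargeE /= cards0 add0r.
rewrite [X in _ - Posz X]big1 => [|j jT]; last first.
  rewrite mulmnE mnm1E; case: eqP => [E|]; last by rewrite mul0n.
  by rewrite E jT in iT.
rewrite (bigD1 i) ?inE //= big1 => [|j /andP[_ ji]].
  by rewrite mulmnE mnm1E eqxx mul1n addn0 subr0.
by rewrite mulmnE mnm1E eq_sym (negPf ji) mul0n.
Qed.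

(** A proper nonzero submodule W would split A'_k as W and P W; irreducibility is thus reduced to
    refuting such a splitting. *)
Lemma irreducible_Vcharge (k : nat) : (exists u, charge u = k) ->
  (forall W f, Qstable z w W -> (forall g, W g -> V k g) -> W f -> f != 0 ->
   (forall g, W g -> Pspan z w W g -> g = 0) ->
   (forall g, V k g -> exists g1 g2, [/\ W g1, Pspan z w W g2 & g = g1 + g2]) ->
   False) ->
  irreducible T (Aprime K m1 T k).
Proof.
move=> [u uk] split_absurd.
have -> : Aprime K m1 T k = V k by apply: funext => f; apply/propext/AprimeE.
split.
- apply/submoduleP; split=> [|a b f]; first exact: Vcharge_subspace.
  exact: (gl_stable_Qop _ _ (Vcharge_gl_stable T k)).
- by exists (bas K u); [apply: Vcharge_bas | apply: bas_neq0].
move=> W /submoduleP qW WV; have [Wf0|nW] := boolp.lem (forall f, W f -> f = 0).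
  by left.
have [VW|nVW] := boolp.lem (forall f, V k f -> W f); first by right.
have [f Wf f0] : exists2 f, W f & f != 0.
  move/existsNP: nW => [f /not_implyP[Wf /eqP f0]]; by exists f.
exfalso; apply: (split_absurd W f qW WV Wf f0).
  by move=> g; apply: submodule_cap qW WV nVW.
exact: submodule_sum qW WV Wf f0.
Qed.

Lemma scoef_Pb u j f :
  scoef u (P (b1 m1 j) (b2 m1 j) f) =
  - (lam T u (b1 m1 j) + lam T u (b2 m1 j) + 1)%:~R * scoef u f.
Proof.
rewrite -star_b1 scoef_Pdiag star_b1 eps_b1 eps_b2 /ksign !fermi_b1 /= expr0.
by move: (lam _ _ _) (lam _ _ _) => x y; rewrite !rmorphD /= rmorph1; ring.
Qed.

Lemma scoef_Pf u i f :
  scoef u (P (f1 n i) (f2 n i) f) =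
  (lam T u (f1 n i) + lam T u (f2 n i) - 1)%:~R * scoef u f.
Proof.
rewrite -star_f1 scoef_Pdiag star_f1 eps_f1 eps_f2 /ksign !fermi_f1 /= expr1.
by move: (lam _ _ _) (lam _ _ _) => x y; rewrite rmorphB rmorphD /= rmorph1; ring.
Qed.

Lemma irreducible_S1T1 (k : nat) : S1 T :|: T1 T != set0 ->
  (T = [set: 'I_N] -> (k <= m)%N) -> irreducible T (Aprime K m1 T k).
Proof.
move=> /set0Pn[j jST] kT; have [u uk] := exists_charge kT.
pose mu (v : {set 'I_m} * 'X_{1..N}) : int := lam T v (b1 m1 j) + lam T v (b2 m1 j) + 1.
(* mu is minus the eigenvalue of P at the pair of j. It is positive everywhere if both members lie
   outside T, negative everywhere if both lie in T. *)
have mu_same v : mu v + mu u != 0.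
  move: jST; rewrite /mu /lam /gam /b1 /b2 !inE !splitE.
  by case: (lshift n j \in T); case: (rshift n j \in T) => //= _; lia.
apply: irreducible_Vcharge; first by exists u.
move=> W f [sW QW] WV Wf f0 cap sum.
have [g [h [Wg Ph ugh]]] := sum _ (@Vcharge_bas K m1 n T k u uk).
have sP : is_subspace (Pspan z w W) by apply: span_subspace.
(* P at this pair, kept opaque: only its eigenvalues, additivity and the exchange of W with P W
   matter. *)
have [p [pE pD pW pP]] : exists p : A' -> A',
    [/\ forall v y, scoef v (p y) = - (mu v)%:~R * scoef v y,
        forall x y, p (x + y) = p x + p y,
        forall y, W y -> Pspan z w W (p y) & forall y, Pspan z w W y -> W (p y)].
  exists (P (b1 m1 j) (b2 m1 j)); split=> [v y|x y|y|y].
  - exact: scoef_Pb.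
  - exact: linearD.
  - exact: Pspan_Pop.
  - exact: (Pop_Pspan zzC wwC wzC zwC xD xZ xP).
have pu : p (bas K u) = - (mu u)%:~R *: bas K u.
  apply: scoefP => v; rewrite pE scoefZ scoef_bas.
  by case: eqP => [->//|_]; rewrite !mulr0.
(* The eigenvector equation for g + h, sorted by component: the left side lies in P W and the right
   side in W, so both vanish. *)
have E : p g + (mu u)%:~R *: h = - (p h + (mu u)%:~R *: g).
  apply/eqP; rewrite -subr_eq0 opprK addrACA -pD -scalerDr [h + g]addrC.
  by rewrite -ugh pu -scalerDl addNr scale0r.
have pgh : p g + (mu u)%:~R *: h = 0.
  apply: cap; last first.
    by apply: (subspaceD sP); [apply: pW | apply: (subspaceZ sP)].
  rewrite E -scaleN1r; apply: (subspaceZ sW); apply: (subspaceD sW).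
    exact: pP.
  exact: (subspaceZ sW).
have phg : p h + (mu u)%:~R *: g = 0 by apply/eqP; rewrite -oppr_eq0 -E pgh.
(* Subtracting the two equations makes g - h an eigenvector of p for the eigenvalue mu u, whereas
   every eigenvalue of p has the form - mu v. *)
have gh : g = h.
  apply/eqP; rewrite -subr_eq0; apply/eqP/scoefP => v; rewrite scoef0.
  have /eqP : (mu v + mu u)%:~R * scoef v (g - h) = 0.
    have e1 : scoef v (p g + (mu u)%:~R *: h) = 0 by rewrite pgh scoef0.
    have e2 : scoef v (p h + (mu u)%:~R *: g) = 0 by rewrite phg scoef0.
    have := congr2 (fun x y => x - y) e2 e1; rewrite subrr => <-.
    rewrite !scoefD scoefN !scoefZ !pE rmorphD /=.
    by move: (_%:~R : K) (_%:~R : K) (scoef v g) (scoef v h) => *; ring.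
  by rewrite mulf_eq0 intr_eq0 (negPf (mu_same v)) => /eqP.
have g0 : g = 0 by apply: cap; rewrite // gh.
by move: (bas_neq0 K u); rewrite ugh -gh g0 addr0 eqxx.
Qed.

(* Summing the zero-weight elements of the complement of osp in gl, one for
   each pair {a, a*}, yields a shifted Euler operator. *)
Lemma scoef_euler u f : S1 T = set0 -> T1 T = set0 ->
  scoef u (\sum_i P (f1 n i) (f2 n i) f - \sum_j P (b1 m1 j) (b2 m1 j) f) =
  (charge u - m1%:Z)%:~R * scoef u f.
Proof.
move=> S10 T10; rewrite scoefD scoefN !scoef_sum.
under eq_bigr => i _ do rewrite scoef_Pf.
under [X in _ - X]eq_bigr => j _ do rewrite scoef_Pb mulNr.
rewrite sumrN opprK -!mulr_suml -mulrDl -!rmorph_sum -rmorphD; congr (_%:~R * _).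
rewrite /charge !big_split_ord /= sumrB sumr_const card_ord.
rewrite -!big_split /= addrAC; congr (_ + _ - _); last by rewrite natz.
  by apply: eq_bigr => i _; rewrite /lam /f1 /f2 !splitE !subr0.
apply: eq_bigr => j _; rewrite /lam /b1 /b2 !splitE.
have /setP/(_ j) := S10; have /setP/(_ j) := T10; rewrite !inE.
by case: (lshift n j \in T); case: (rshift n j \in T) => //= _ _; lia.
Qed.

Lemma irreducible_neq (k : nat) : (0 < n)%N -> S1 T = set0 -> T1 T = set0 ->
  k <> m1 -> irreducible T (Aprime K m1 T k).
Proof.
move=> n0 S10 T10 km1; apply: irreducible_Vcharge.
  apply: exists_charge => TT; have /setP/(_ (Ordinal n0)) := T10.
  by rewrite TT !inE.
move=> W f [sW QW] WV Wf f0 cap _; move/eqP: f0; apply.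
have sP : is_subspace (Pspan z w W) by apply: span_subspace.
(* The shifted Euler operator is a combination of P's, so it sends f into P W; on A'_k it is the
   nonzero scalar k - m1. *)
apply: cap => //; apply: (subspaceZK sP (c := (k%:Z - m1%:Z)%:~R)).
  by rewrite intr_eq0 subr_eq0; apply/eqP; case.
have -> : (k%:Z - m1%:Z)%:~R *: f =
    \sum_i P (f1 n i) (f2 n i) f - \sum_j P (b1 m1 j) (b2 m1 j) f.
  apply: scoefP => u; rewrite scoef_euler // scoefZ.
  by have [->|/(WV f Wf)->//] := eqVneq (scoef u f) 0; rewrite !mulr0.
by apply: (subspaceB sP); apply: (subspace_sum sP) => *; apply: Pspan_Pop.
Qed.

Lemma xmul_eq0 i (f : A') : xmul i f = 0 -> f = 0.
Proof.
move/ffunP=> xf; apply/ffunP=> Y; have /eqP := xf Y; rewrite !ffunE mulf_eq0.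
case/orP=> [|/eqP //]; move/eqP/(congr1 (mcoeff U_(i)%MM)).
by rewrite mcoeffX mcoeff0 eqxx => /eqP; rewrite oner_eq0.
Qed.

(** For q in S_1 and r in T_1 the long roots give x_q d_(n+q) f = 0 and x_(n+r) d_r f = 0, so both
    derivatives of f vanish. The root vector mixing q and r then reduces to - x_q x_(n+r), which is
    injective. *)
Lemma no_highest_weight_vector f : S1 T != set0 -> T1 T != set0 ->
  ~ highest_weight_vector T f.
Proof.
move=> /set0Pn[q]; rewrite inE => /andP[/negPf q1 /negPf q2].
move=> /set0Pn[r]; rewrite inE => /andP[r1 r2] [f0 _ pf].
have actE i j : act T (delta_mx (b1 m1 i) (b2 m1 j) + delta_mx (b1 m1 j) (b2 m1 i)) f = 0.
  (* The element is symmetric in i and j, while the generators of [osp_plus] are listed for ordered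
     pairs. *)
  have [ij|/ltnW ji] := leqP i j; last rewrite addrC.
    by apply: pf; apply: span_gen; right; right; left; exists (i, j).
  by apply: pf; apply: span_gen; right; right; left; exists (j, i).
have diag i : E_act T (b1 m1 i) (b2 m1 i) f = 0.
  apply/eqP; have /eqP := actE i i; rewrite actD act_delta -mulr2n -scaler_nat.
  by rewrite scaler_eq0 pnatr_eq0.
have dq : dx (rshift n q) f = 0.
  by have := diag q; rewrite E_actE zop_rshift dop_rshift q1 q2 => /xmul_eq0.
have dr : dx (lshift n r) f = 0.
  have := diag r; rewrite E_actE zop_rshift dop_rshift r1 r2 dxN dx_xmul.
  rewrite eq_lrshift addr0 => /eqP; rewrite oppr_eq0 => /eqP.
  exact: xmul_eq0.
have := actE q r; rewrite actD !act_delta !E_actE !zop_rshift !dop_rshift.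
rewrite q1 q2 r1 r2 dq linear0 addr0 xmulN => /eqP; rewrite oppr_eq0 => /eqP.
by move=> /xmul_eq0/xmul_eq0 /eqP; rewrite (negPf f0).
Qed.

End Irreducibility.

(** * The involution sigma *)

Section FermionReflection.
Variables (K : numFieldType) (m N : nat).
Local Notation A' := (superpoly K m N).
Implicit Types (p q r : 'I_m) (f g : A').

Lemma thetaP p c f g : theta p (c *: f + g) = c *: theta p f + theta p g.
Proof. exact: linearP. Qed.
Lemma dthetaP p c f g : dtheta p (c *: f + g) = c *: dtheta p f + dtheta p g.
Proof. exact: linearP. Qed.
Lemma thetaD p f g : theta p (f + g) = theta p f + theta p g.
Proof. exact: linearD. Qed.
Lemma dthetaD p f g : dtheta p (f + g) = dtheta p f + dtheta p g.
Proof. exact: linearD. Qed.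
Lemma thetaZ p c f : theta p (c *: f) = c *: theta p f.
Proof. exact: linearZ. Qed.
Lemma dthetaZ p c f : dtheta p (c *: f) = c *: dtheta p f.
Proof. exact: linearZ. Qed.

(** A vector of the Clifford algebra; [clif_anticomm] gives the polar form of its quadratic form. *)
Definition clif p q (e : K) f : A' := theta p f + e *: dtheta q f.

Lemma clif_is_linear p q e : linear (clif p q e).
Proof.
move=> c f g; rewrite /clif thetaP dthetaP !scalerDr !scalerA [e * c]mulrC.
by rewrite addrACA.
Qed.
HB.instance Definition _ p q e :=
  GRing.isLinear.Build K A' A' _ (clif p q e) (clif_is_linear p q e).

Lemma clifN p q e f : clif p q e (- f) = - clif p q e f.
Proof. exact: linearN. Qed.
Lemma clifD p q e f g : clif p q e (f + g) = clif p q e f + clif p q e g.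
Proof. exact: linearD. Qed.
Lemma clifZ p q e k f : clif p q e (k *: f) = k *: clif p q e f.
Proof. exact: linearZ. Qed.

Lemma clif_anticomm p q e p' q' e' f :
  clif p q e (clif p' q' e' f) =
  - clif p' q' e' (clif p q e f)
  + (e' * (p == q')%:R + e * (q == p')%:R) *: f.
Proof.
have dt i j : dtheta i (theta j f) = (i == j)%:R *: f - theta j (dtheta i f).
  by rewrite dtheta_theta; case: eqP => _; rewrite ?scale1r ?scale0r.
rewrite /clif !(thetaD, dthetaD, thetaZ, dthetaZ) [theta p (theta p' f)]theta_anticomm.
rewrite [dtheta q (dtheta q' f)]dtheta_anticomm !dt [q' == p]eq_sym.
move: (dtheta _ (dtheta _ _)) (theta p _) (theta p' _) (theta p' _) => a b c d.
by apply: scoefP => u; rewrite !(scoefD, scoefN, scoefZ); ring.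
Qed.

Section Pair.
Variables p q : 'I_m.
Hypothesis pq : p != q.
Local Notation A := (clif p q (-1)).
Local Notation B := (clif q p (-1)).
Local Notation C := (clif p q 1).
Local Notation D := (clif q p 1).

(* The product of the reflections along the vectors theta_p - d_q and
   theta_q - d_p: conjugation by it exchanges theta_p with d_q and theta_q
   with d_p. *)
Definition pair_swap f : A' := f + A (B f).

Lemma pair_swap_is_linear : linear pair_swap.
Proof. by move=> c f g; rewrite /pair_swap !linearP scalerDr addrACA. Qed.
HB.instance Definition _ :=
  GRing.isLinear.Build K A' A' _ pair_swap pair_swap_is_linear.

Lemma pair_swap_comm (g : {linear A' -> A'}) f :
  (forall h, A (g h) = - g (A h)) -> (forall h, B (g h) = - g (B h)) ->
  pair_swap (g f) = g (pair_swap f).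
Proof. by move=> gA gB; rewrite /pair_swap gB clifN gA opprK [RHS]linearD. Qed.

Lemma clif_sqr0 e f : clif p q e (clif p q e f) = 0.
Proof.
apply/eqP; have /eqP := clif_anticomm p q e p q e f.
rewrite [q == p]eq_sym (negPf pq) !mulr0 addr0 scale0r addr0 -subr_eq0 opprK -mulr2n.
by rewrite -scaler_nat scaler_eq0 pnatr_eq0.
Qed.

End Pair.

Lemma clif_dualC p q f : p != q ->
  clif q p (-1) (clif p q (-1) f) = - clif p q (-1) (clif q p (-1) f) - 2%:R *: f.
Proof.
move=> pq; rewrite clif_anticomm !eqxx !mulr1; congr (_ + _).
by rewrite -scaleNr; congr (_ *: _); rewrite opprD.
Qed.

(** A and B are isotropic with AB + BA = -2, so (1 + AB)A = -A = -A(1 + AB). Conjugation by 1 + AB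
    is thus -1 on the plane of A and B, and 1 on that of C and D, which anticommute with both. *)
Lemma pair_swapA p q f : p != q ->
  pair_swap p q (clif p q (-1) f) = - clif p q (-1) (pair_swap p q f).
Proof.
move=> pq; rewrite /pair_swap (clif_dualC f pq) [clif _ _ _ (_ - _)]clifD.
rewrite clifN -scaleNr clifZ.
rewrite [clif _ _ _ (f + _)]clifD !clif_sqr0 // scaleNr.
by rewrite oppr0 sub0r addr0 scaler_nat mulr2n opprD addrA subrr sub0r.
Qed.

Lemma pair_swapB p q f : p != q ->
  pair_swap p q (clif q p (-1) f) = - clif q p (-1) (pair_swap p q f).
Proof.
move=> pq; have qp : q != p by rewrite eq_sym.
rewrite /pair_swap clif_sqr0 // linear0 addr0 [clif _ _ _ (f + _)]clifD.
rewrite (clif_dualC _ pq) clif_sqr0 //.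
by rewrite linear0 oppr0 sub0r scaler_nat mulr2n opprB addrK.
Qed.

Lemma pair_swapC p q f : p != q ->
  pair_swap p q (clif p q 1 f) = clif p q 1 (pair_swap p q f).
Proof.
move=> pq; apply: pair_swap_comm => h; rewrite clif_anticomm.
  by rewrite [q == p]eq_sym (negPf pq) !mulr0 addr0 scale0r addr0.
by rewrite !eqxx !mulr1 subrr scale0r addr0.
Qed.

Lemma pair_swapD p q f : p != q ->
  pair_swap p q (clif q p 1 f) = clif q p 1 (pair_swap p q f).
Proof.
move=> pq; apply: pair_swap_comm => h; rewrite clif_anticomm.
  by rewrite !eqxx !mulr1 subrr scale0r addr0.
by rewrite [q == p]eq_sym (negPf pq) !mulr0 addr0 scale0r addr0.
Qed.

Lemma theta_clif p q f : theta p f = 2%:R^-1 *: (clif p q (-1) f + clif p q 1 f).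
Proof.
rewrite /clif addrACA -scalerDl addNr scale0r addr0 -mulr2n -scaler_nat scalerA.
by rewrite mulVf ?scale1r // pnatr_eq0.
Qed.

Lemma dtheta_clif p q f : dtheta q f = 2%:R^-1 *: (clif p q 1 f - clif p q (-1) f).
Proof.
rewrite /clif opprD addrACA subrr add0r -scalerBl opprK -mulr2n scalerA.
by rewrite mulVf ?scale1r // pnatr_eq0.
Qed.

(** theta_p is (A + C)/2 and d_q is (C - A)/2, so negating A and fixing C exchanges them. The three
    variants below are alike. *)
Lemma pair_swap_theta1 p q f : p != q ->
  pair_swap p q (theta p f) = dtheta q (pair_swap p q f).
Proof.
move=> pq; rewrite (theta_clif p q) (dtheta_clif p q) linearZ linearD /=.
by rewrite pair_swapA // pair_swapC // addrC.
Qed.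

Lemma pair_swap_theta2 p q f : p != q ->
  pair_swap p q (theta q f) = dtheta p (pair_swap p q f).
Proof.
move=> pq; rewrite (theta_clif q p) (dtheta_clif q p) linearZ linearD /=.
by rewrite pair_swapB // pair_swapD // addrC.
Qed.

Lemma pair_swap_dtheta1 p q f : p != q ->
  pair_swap p q (dtheta p f) = theta q (pair_swap p q f).
Proof.
move=> pq; rewrite (theta_clif q p) (dtheta_clif q p) linearZ linearB /=.
by rewrite pair_swapB // pair_swapD // opprK addrC.
Qed.

Lemma pair_swap_dtheta2 p q f : p != q ->
  pair_swap p q (dtheta q f) = theta p (pair_swap p q f).
Proof.
move=> pq; rewrite (theta_clif p q) (dtheta_clif p q) linearZ linearB /=.
by rewrite pair_swapA // pair_swapC // opprK addrC.
Qed.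

Lemma clif_theta p q e r f : q != r -> clif p q e (theta r f) = - theta r (clif p q e f).
Proof.
move=> qr; rewrite /clif theta_anticomm dtheta_theta (negPf qr) sub0r thetaD thetaZ.
by rewrite scalerN opprD.
Qed.

Lemma clif_dtheta p q e r f : p != r -> clif p q e (dtheta r f) = - dtheta r (clif p q e f).
Proof.
move=> pr; rewrite /clif dtheta_anticomm dthetaD dthetaZ dtheta_theta.
by rewrite eq_sym (negPf pr) sub0r opprD opprK scalerN.
Qed.

Lemma pair_swap_theta p q r f : p != r -> q != r ->
  pair_swap p q (theta r f) = theta r (pair_swap p q f).
Proof. by move=> pr qr; apply: pair_swap_comm => h; apply: clif_theta. Qed.

Lemma pair_swap_dtheta p q r f : p != r -> q != r ->
  pair_swap p q (dtheta r f) = dtheta r (pair_swap p q f).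
Proof. by move=> pr qr; apply: pair_swap_comm => h; apply: clif_dtheta. Qed.

(** Such an f is killed by A, so AB f = -2 f. *)
Lemma pair_swap_id p q f : p != q -> theta p f = 0 -> dtheta q f = 0 ->
  pair_swap p q f = - f.
Proof.
move=> pq tf df; rewrite /pair_swap clif_anticomm !eqxx !mulr1.
have -> : clif p q (-1) f = 0 by rewrite /clif tf df scaler0 addr0.
rewrite linear0 oppr0 add0r -{1}[f]scale1r -scalerDl addrA subrr add0r.
by rewrite scaleN1r.
Qed.

End FermionReflection.

(** * The bosonic factor of sigma: a signed exchange of the two halves of the variables *)

Section SignedSwap.
Variables (K : numFieldType) (m n : nat).
Local Notation N := (n + n)%N.
Local Notation A' := (superpoly K m N).
Variable sg : 'I_N -> K.
Hypothesis sg_sqr : forall i, sg i * sg i = 1.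

Definition msubst (p : {mpoly K[N]}) : {mpoly K[N]} :=
  p \mPo [tuple sg i *: 'X_(swap_half i) | i < N].

Lemma msubst_is_linear : linear msubst.
Proof. by move=> c p q; rewrite /msubst linearP. Qed.
HB.instance Definition _ :=
  GRing.isLinear.Build K {mpoly K[N]} {mpoly K[N]} _ msubst msubst_is_linear.

Lemma msubstM p q : msubst (p * q) = msubst p * msubst q.
Proof. by rewrite /msubst rmorphM. Qed.

Lemma msubst1 : msubst 1 = 1.
Proof. exact: comp_mpoly1. Qed.

Lemma msubstX i : msubst 'X_i = sg i *: 'X_(swap_half i).
Proof. by rewrite /msubst comp_mpolyXU -tnth_nth tnth_mktuple. Qed.

(** Chain rule for the substitution. It holds for 1 and the variables and passes to products and
    linear combinations. *)
Lemma mderiv_msubst i p :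
  (msubst p)^`M(swap_half i) = sg i *: msubst p^`M(i).
Proof.
pose D p := (msubst p)^`M(swap_half i) = sg i *: msubst p^`M(i).
have DM q r : D q -> D r -> D (q * r).
  rewrite /D => Dq Dr; rewrite msubstM !mderivM Dq Dr linearD /= !msubstM.
  by rewrite scalerDr -scalerAl -scalerAr.
have D1 : D 1 by rewrite /D msubst1 -mpolyC1 !mderivC linear0 scaler0.
have DX j : D 'X_j.
  rewrite /D msubstX linearZ /= !mderivX !mnm1E (inj_eq (inv_inj (@swap_halfK n))).
  case: eqP => [->|_]; last by rewrite !scale0r !linear0.
  have subUU k : (U_(k) - U_(k))%MM = 0%MM :> 'X_{1..N}.
    by rewrite -[X in (X - _)%MM]add0m addmK.
  by rewrite !subUU !mpolyX0 !scale1r msubst1.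
have DXal al : D 'X_[al].
  rewrite mpolyXE_id; apply: (big_ind D) => [|q r|j _]; [exact: D1 | exact: DM |].
  by elim: (al j) => [|k IH]; [exact: D1 | rewrite exprS; exact: DM].
rewrite -/(D p); elim/mpolyind: p => [|c al p _ _ Dp].
  by rewrite /D !linear0.
rewrite /D !linearP /= Dp; congr (_ *: _ + _).
exact: DXal.
Qed.

Definition bswap (f : A') : A' := [ffun S => msubst (f S)].

Lemma bswap_is_linear : linear bswap.
Proof. by move=> c f g; apply/ffunP=> S; rewrite !ffunE linearP. Qed.
HB.instance Definition _ :=
  GRing.isLinear.Build K A' A' _ bswap bswap_is_linear.

Lemma msubst_sign k p : msubst ((-1) ^+ k * p) = (-1) ^+ k * msubst p.
Proof. by rewrite -signr_odd; case: odd; rewrite ?mulN1r ?mul1r ?linearN. Qed.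

Lemma bswap_theta p f : bswap (theta p f) = theta p (bswap f).
Proof.
by apply/ffunP=> S; rewrite !ffunE; case: ifP; rewrite ?linear0 // msubst_sign.
Qed.

Lemma bswap_dtheta p f : bswap (dtheta p f) = dtheta p (bswap f).
Proof.
by apply/ffunP=> S; rewrite !ffunE; case: ifP; rewrite ?linear0 // msubst_sign.
Qed.

Lemma bswap_xmul i f : bswap (xmul i f) = sg i *: xmul (swap_half i) (bswap f).
Proof. by apply/ffunP=> S; rewrite !ffunE msubstM msubstX scalerAl. Qed.

Lemma bswap_dx i f : bswap (dx i f) = sg i *: dx (swap_half i) (bswap f).
Proof.
by apply/ffunP=> S; rewrite !ffunE mderiv_msubst scalerA sg_sqr scale1r.
Qed.

Lemma bswap_bas0 Y : bswap (bas K (Y, 0%MM)) = bas K (Y, 0%MM).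
Proof.
apply/ffunP=> S; rewrite !ffunE /=; case: eqP => _; last exact: linear0.
by rewrite mpolyX0 msubst1.
Qed.

End SignedSwap.

(** * The fermionic factor of sigma: a product of pair swaps *)

Section FermionSwap.
Variables (K : numFieldType) (m1 N : nat).
Local Notation A' := (superpoly K (m1 + m1) N).
Implicit Types (f : A') (p : 'I_(m1 + m1)) (r : seq 'I_m1).

Definition fswap r f : A' :=
  foldr (fun i => pair_swap (lshift m1 i) (rshift m1 i)) f r.

Lemma fswap_is_linear r : linear (fswap r).
Proof.
by move=> c f g; elim: r => //= i r ->; exact: linearP.
Qed.
HB.instance Definition _ r := GRing.isLinear.Build K A' A' _ (fswap r) (fswap_is_linear r).

Definition half p : 'I_m1 := match split p with inl i => i | inr i => i end.

(** Stated for a partial list of pairs to make the induction work: a generator is exchanged once its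
    own pair has been treated, and commutes with all other pair swaps. *)
Lemma fswap_gen r p f : uniq r ->
  fswap r (theta p f) =
    (if half p \in r then dtheta (swap_half p) (fswap r f) else theta p (fswap r f))
  /\ fswap r (dtheta p f) =
    (if half p \in r then theta (swap_half p) (fswap r f) else dtheta p (fswap r f)).
Proof.
have lr i : lshift m1 i != rshift m1 i :> 'I_(m1 + m1) by rewrite eq_lrshift.
elim: r f => [|i r IH] f //= /andP[ir /IH{}IH]; rewrite inE.
have [-> ->] := IH f; case: (split_ordP p) => j ->; rewrite /half /swap_half !splitE.
  case: (eqVneq j i) => [->|ji] /=.
    by rewrite (negPf ir) pair_swap_theta1 // pair_swap_dtheta1.
  have ij : lshift m1 i != lshift m1 j by rewrite (inj_eq (@lshift_inj _ _)) eq_sym.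
  have ij' : rshift m1 i != rshift m1 j by rewrite (inj_eq (@rshift_inj _ _)) eq_sym.
  case: (j \in r); rewrite ?(pair_swap_theta, pair_swap_dtheta) //;
  by rewrite ?eq_lrshift ?eq_rlshift.
case: (eqVneq j i) => [->|ji] /=.
  by rewrite (negPf ir) pair_swap_theta2 // pair_swap_dtheta2.
have ij : lshift m1 i != lshift m1 j by rewrite (inj_eq (@lshift_inj _ _)) eq_sym.
have ij' : rshift m1 i != rshift m1 j by rewrite (inj_eq (@rshift_inj _ _)) eq_sym.
case: (j \in r); rewrite ?(pair_swap_theta, pair_swap_dtheta) //;
by rewrite ?eq_lrshift ?eq_rlshift.
Qed.

Lemma fswap_theta p f :
  fswap (enum 'I_m1) (theta p f) = dtheta (swap_half p) (fswap (enum 'I_m1) f).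
Proof. by have [-> _] := @fswap_gen (enum 'I_m1) p f (enum_uniq _); rewrite mem_enum. Qed.

Lemma fswap_dtheta p f :
  fswap (enum 'I_m1) (dtheta p f) = theta (swap_half p) (fswap (enum 'I_m1) f).
Proof. by have [_ ->] := @fswap_gen (enum 'I_m1) p f (enum_uniq _); rewrite mem_enum. Qed.

Lemma fswap_vacuum r f :
  (forall i, theta (lshift m1 i) f = 0) -> (forall i, dtheta (rshift m1 i) f = 0) ->
  fswap r f = (-1) ^+ size r *: f.
Proof.
move=> tf df; elim: r => [|i r IH] /=; first by rewrite scale1r.
rewrite IH linearZ /= pair_swap_id // ?eq_lrshift //.
by rewrite exprS mulN1r scalerN scaleNr.
Qed.

End FermionSwap.

(** * The splitting for k = m_1 *)

Section Splitting.
Variables (K : numFieldType) (m1 n : nat).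
Local Notation m := (m1 + m1)%N.
Local Notation N := (n + n)%N.
Local Notation A' := (superpoly K m N).
Local Notation I := 'I_(m + N).
Variable T : {set 'I_N}.
Hypotheses (S10 : S1 T = set0) (T10 : T1 T = set0).
Implicit Types (a b : I) (i : 'I_N) (f g : A') (W : A' -> Prop).
Local Notation eps := (@dual_sign K m1 n).
Local Notation z := (@zlin K m1 n T).
Local Notation w := (@wlin K m1 n T).
Local Notation Q := (Qop z w).
Local Notation P := (Pop z w).
Local Notation V := (Vcharge T m1%:Z).

(** As S_1 and T_1 are empty, T meets each pair {j, n + j} exactly once. *)
Lemma swap_half_T i : (swap_half i \in T) = (i \notin T).
Proof.
case: (split_ordP i) => j ->; rewrite /swap_half splitE;
have /setP/(_ j) := S10; have /setP/(_ j) := T10; rewrite !inE;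
by case: (lshift n j \in T); case: (rshift n j \in T).
Qed.

(** Chosen to make [sigma_z] true: for i outside T the dual index lies in T, where d is -x, which
    accounts for the second factor. *)
Definition sgb i : K := eps (rshift m i) * (-1) ^+ (i \notin T).

Lemma sgb_sqr i : sgb i * sgb i = 1.
Proof. by rewrite /sgb mulrACA eps_sqr mul1r -expr2 sqrr_sign. Qed.

(* The nontrivial component of the dual group O(2): it exchanges the two copies
   z and w of the defining representation. *)
Definition sigma f : A' := bswap sgb (fswap (enum 'I_m1) f).

Lemma sigma_is_linear : linear sigma.
Proof. by move=> c f g; rewrite /sigma !linearP. Qed.
HB.instance Definition _ := GRing.isLinear.Build K A' A' _ sigma sigma_is_linear.

Lemma fswap_comm (g : {linear A' -> A'}) r f :
  (forall p h, theta p (g h) = g (theta p h)) ->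
  (forall p h, dtheta p (g h) = g (dtheta p h)) -> fswap r (g f) = g (fswap r f).
Proof.
move=> gt gd; have gc p q e h : clif p q e (g h) = g (clif p q e h).
  by rewrite /clif gt gd [RHS]linearD linearZ.
by elim: r => //= p r ->; rewrite /pair_swap !gc [RHS]linearD.
Qed.

Lemma sigma_theta p f : sigma (theta p f) = dtheta (swap_half p) (sigma f).
Proof. by rewrite /sigma fswap_theta bswap_dtheta. Qed.

Lemma sigma_dtheta p f : sigma (dtheta p f) = theta (swap_half p) (sigma f).
Proof. by rewrite /sigma fswap_dtheta bswap_theta. Qed.

Lemma sigma_xmul i f : sigma (xmul i f) = sgb i *: xmul (swap_half i) (sigma f).
Proof.
rewrite /sigma (fswap_comm (g := xmul i)) ?bswap_xmul // => p h.
  exact: theta_xmul.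
exact: dtheta_xmul.
Qed.

Lemma sigma_dx i f : sigma (dx i f) = sgb i *: dx (swap_half i) (sigma f).
Proof.
rewrite /sigma (fswap_comm (g := dx i)) ?bswap_dx // => [j|p h|p h].
- exact: sgb_sqr.
- exact: theta_dx.
exact: dtheta_dx.
Qed.

Lemma star_lshift (p : 'I_m) : star (lshift N p) = lshift N (swap_half p).
Proof. by rewrite /star splitE. Qed.

Lemma star_rshift i : star (rshift m i) = rshift m (swap_half i).
Proof. by rewrite /star splitE. Qed.

Lemma eps_lshift (p : 'I_m) : eps (lshift N p) = 1.
Proof. by rewrite /dual_sign /in_b2 splitE. Qed.

Lemma eps_swap i : eps (rshift m (swap_half i)) = - eps (rshift m i).
Proof. by rewrite -star_rshift eps_star /ksign /fermi splitE /= mulN1r. Qed.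

Lemma sigmaZ k f : sigma (k *: f) = k *: sigma f. Proof. exact: linearZ. Qed.
Lemma sigmaN f : sigma (- f) = - sigma f. Proof. exact: linearN. Qed.

Lemma sigma_z a f : sigma (z a f) = w a (sigma f).
Proof.
change (sigma (zop T a f) = wop T a (sigma f)); rewrite wopE.
case: (split_ordP a) => [p|i] ->.
  by rewrite star_lshift eps_lshift zop_lshift dop_lshift sigma_theta scale1r.
rewrite star_rshift zop_rshift dop_rshift swap_half_T.
case iT: (i \in T); rewrite ?(sigma_dx, sigma_xmul) /sgb iT /=.
  by rewrite expr0 mulr1.
by rewrite expr1 mulrN1 scaleNr scalerN.
Qed.

Lemma sigma_w a f : sigma (w a f) = z a (sigma f).
Proof.
change (sigma (wop T a f) = zop T a (sigma f)); rewrite wopE sigmaZ.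
case: (split_ordP a) => [p|i] ->.
  by rewrite star_lshift eps_lshift zop_lshift dop_lshift sigma_dtheta swap_halfK scale1r.
rewrite star_rshift zop_rshift dop_rshift swap_half_T.
case iT: (i \in T); rewrite /= ?sigmaN ?(sigma_dx, sigma_xmul) /sgb swap_half_T iT /=;
  rewrite swap_halfK eps_swap.
  by rewrite expr1 mulrN1 opprK scalerA eps_sqr scale1r.
by rewrite expr0 mulr1 scaleNr opprK scalerA eps_sqr scale1r.
Qed.

Lemma sigma_Q a b f : sigma (Q a b f) = Q a b (sigma f).
Proof. by rewrite /Qop linearD /= !(sigma_z, sigma_w) addrC. Qed.

Lemma sigma_P a b f : sigma (P a b f) = - P a b (sigma f).
Proof. by rewrite /Pop linearB /= !(sigma_z, sigma_w) opprB. Qed.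

Definition Vsig (e : K) f : Prop := V f /\ sigma f = e *: f.

Lemma Vsig_Qstable e : Qstable z w (Vsig e).
Proof.
split=> [|a b f [Vf sf]].
  split=> [|c f g [Vf sf] [Vg sg]].
    by split; [apply: subspace0 (Vcharge_subspace _ _) | rewrite linear0 scaler0].
  split; first exact: (Vcharge_subspace T m1%:Z).2.
  by rewrite linearP /= sf sg scalerDr !scalerA mulrC.
split; first exact: (gl_stable_Qop _ _ (Vcharge_gl_stable T _)).
by rewrite sigma_Q sf linearZ.
Qed.

Lemma Vsig_Pop e a b f : Vsig e f -> Vsig (- e) (P a b f).
Proof.
move=> [Vf sf]; split; first exact: (gl_stable_Pop _ _ (Vcharge_gl_stable T _)).
by rewrite sigma_P sf linearZ scaleNr.
Qed.

Lemma Pspan_Vsig e W f : (forall g, W g -> Vsig e g) -> Pspan z w W f -> Vsig (- e) f.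
Proof.
move=> We; apply; first by case: (Vsig_Qstable (- e)).
by move=> _ [a [b [g [/We Wg ->]]]]; apply: Vsig_Pop.
Qed.

Lemma Vsig_cap e f : e != 0 -> Vsig e f -> Vsig (- e) f -> f = 0.
Proof.
move=> e0 [_ ef] [_ nef]; apply/eqP.
have /eqP : e *: f + e *: f = 0 by rewrite -{1}ef nef scaleNr addNr.
by rewrite -scalerDl scaler_eq0 -mulr2n mulrn_eq0 /= (negPf e0).
Qed.

Lemma Vsig_split e W f : e != 0 -> Qstable z w W -> (forall g, W g -> Vsig e g) ->
  W f -> f != 0 ->
  forall g, V g -> exists g1 g2, [/\ W g1, Pspan z w W g2 & g = g1 + g2].
Proof.
move=> e0 qW We Wf f0; apply: (submodule_sum qW _ Wf f0) => g /We[].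
by [].
Qed.

(** A'_(m_1) is W + P W, and P W lies in the eigenspace for -e because the P's anticommute with
    sigma. So the P W component of a vector in the eigenspace for e vanishes. *)
Lemma Vsig_minimal e W f : e != 0 -> Qstable z w W -> (forall g, W g -> Vsig e g) ->
  W f -> f != 0 -> forall g, Vsig e g -> W g.
Proof.
move=> e0 qW We Wf f0 g eg; have [g1 [g2 [W1 P2 E]]] := Vsig_split e0 qW We Wf f0 eg.1.
suff g20 : g2 = 0 by rewrite E g20 addr0.
apply: (Vsig_cap e0 _ (Pspan_Vsig We P2)).
rewrite -[g2](addKr g1) -E addrC; have [sV _] := Vsig_Qstable e.
by apply: (subspaceB sV) => //; apply: We.
Qed.

Lemma Vsig_irreducible e f : e != 0 -> Vsig e f -> f != 0 -> irreducible T (Vsig e).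
Proof.
move=> e0 ef f0; split=> [||W /submoduleP qW We].
- exact/submoduleP/Vsig_Qstable.
- by exists f.
have [W0|nW] := boolp.lem (forall f, W f -> f = 0); [by left | right].
move/existsNP: nW => [g /not_implyP[Wg /eqP g0]].
exact: Vsig_minimal Wg g0.
Qed.

Lemma generated_submodule f : is_submodule T (generated T f).
Proof.
split=> [|X g oX Gg U sU Uf]; last exact: sU.2 (Gg U sU Uf).
split=> [U [sU _] _|c g h Gg Gh U sU Uf]; first exact: subspace0.
by apply: sU.1.2; [apply: Gg | apply: Gh].
Qed.

Lemma Vsig_generated e f : e != 0 -> Vsig e f -> f != 0 -> generated T f = Vsig e.
Proof.
move=> e0 ef f0; apply: funext => g; apply: propext; split.
  by apply=> //; apply/submoduleP/Vsig_Qstable.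
have /submoduleP qG := generated_submodule f.
apply: (Vsig_minimal e0 qG _ _ f0) => [h|U _ //].
by apply=> //; apply/submoduleP/Vsig_Qstable.
Qed.

Let Y : {set 'I_m} := [set p in [seq lshift m1 j | j <- enum 'I_m1]].

Let lshift_Y (j : 'I_m1) : lshift m1 j \in Y.
Proof. by rewrite inE map_f // mem_enum. Qed.

Let rshift_Y (j : 'I_m1) : rshift m1 j \notin Y.
Proof. by rewrite inE; apply/mapP=> -[j' _] /eqP; rewrite eq_rlshift. Qed.

Lemma theta_topE : exists2 c, c != 0 & theta_top K m1 n = c *: bas K (Y, 0%MM).
Proof.
have [c Ec cu] := @supermonoE K m N 0%MM [seq lshift m1 j | j <- enum 'I_m1].
by exists c => //; rewrite cu map_inj_uniq ?enum_uniq //; apply: lshift_inj.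
Qed.

Let sgn : K := (-1) ^+ size (enum 'I_m1).

Let sgn_neq0 : sgn != 0. Proof. by rewrite signr_eq0. Qed.

(** This monomial is killed by theta_i and d_(m_1+i), so each of the m_1 pair swaps contributes -1;
    the bosonic factor acts trivially, no x being present. *)
Lemma theta_top_Vsig : Vsig sgn (theta_top K m1 n).
Proof.
have [c _ ->] := theta_topE; apply: (subspaceZ (Vsig_Qstable sgn).1); split.
  apply: Vcharge_bas; rewrite chargeE /= !big1 ?subrr ?addr0 //;
    try by move=> i _; rewrite mnm0E.
  by rewrite cardsE card_image ?card_ord //; apply: lshift_inj.
rewrite /sigma fswap_vacuum => [|i|i].
- by rewrite linearZ /= bswap_bas0.
- by rewrite theta_bas lshift_Y.
by rewrite dtheta_bas (negPf (rshift_Y i)).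
Qed.

Lemma theta_top_neq0 : theta_top K m1 n != 0.
Proof.
by have [c c0 ->] := theta_topE; rewrite scaler_eq0 negb_or c0 bas_neq0.
Qed.

Lemma Vsig_neg_neq0 : (0 < m1)%N -> exists2 f, Vsig (- sgn) f & f != 0.
Proof.
(* For this fermionic index P_aa is twice theta_(m_1+i) d_i, which replaces one theta of the product
   by its dual. The witness works for every n, whereas a minor needs two distinct bosonic
   indices. *)
move=> hm1; pose i := Ordinal hm1; pose a : I := f2 n i.
exists (P a a (theta_top K m1 n)); first exact: Vsig_Pop theta_top_Vsig.
have -> : P a a (theta_top K m1 n) =
    2%:R *: theta (rshift m1 i) (dtheta (lshift m1 i) (theta_top K m1 n)).
  rewrite /Pop /= !wopE star_f2 eps_f2 !scale1r zop_lshift dop_lshift /f1 zop_lshift.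
  rewrite dop_lshift dtheta_theta eq_lrshift sub0r opprK -mulr2n.
  by rewrite -scaler_nat.
have [c c0 ->] := theta_topE.
rewrite dthetaZ dtheta_bas lshift_Y !thetaZ theta_bas in_setD1.
rewrite (negPf (rshift_Y i)) andbF.
by rewrite !scaler_eq0 !negb_or pnatr_eq0 c0 !nsign_neq0 bas_neq0.
Qed.

(** For this T all the signs [sgb] are 1, and exchanging x_j with x_(n+j) negates the minor. *)
Lemma theta_top_minor_Vsig p q : T = first_half n ->
  Vsig (- sgn) (theta_top_minor K m1 p q).
Proof.
move=> TE; have lT j : lshift n j \in T by rewrite TE imset_f.
have rT j : rshift n j \notin T.
  by rewrite TE; apply/imsetP=> -[j' _] /eqP; rewrite eq_rlshift.
have [Vt st] := theta_top_Vsig; split.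
  (* Multiplication by x_i x_(n+j) is, up to sign, a gl operator z d, hence preserves the charge. *)
  have Vx (i j : 'I_n) : V (xmul (lshift n i) (xmul (rshift n j) (theta_top K m1 n))).
    have := @Vcharge_zd K m1 n T m1%:Z (rshift m (rshift n j)) (rshift m (lshift n i)) _ Vt.
    rewrite zop_rshift (negPf (rT j)) dop_rshift lT xmulN xmulC -scaleN1r.
    by apply: (subspaceZK (Vcharge_subspace T m1%:Z)); rewrite oppr_eq0 oner_eq0.
  by apply: (subspaceB (Vcharge_subspace T m1%:Z)).
have sl j : sgb (lshift n j) = 1.
  by rewrite /sgb lT expr0 mulr1; apply: eps_b1.
have sr j : sgb (rshift n j) = 1.
  by rewrite /sgb rT expr1 (eps_b2 K m1 j : eps _ = _) mulrNN mulr1.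
have lr j : swap_half (lshift n j) = rshift n j by rewrite /swap_half splitE.
have rl j : swap_half (rshift n j) = lshift n j by rewrite /swap_half splitE.
rewrite /theta_top_minor linearB /= !sigma_xmul !sl !sr !scale1r !lr !rl st.
have xZ j h : xmul j (sgn *: h) = sgn *: xmul j h by exact: linearZ.
rewrite !xZ -scalerBr scaleNr -scalerN opprB.
by congr (_ *: (_ - _)); apply: xmulC.
Qed.

Lemma theta_top_minor_neq0 (p q : 'I_n) : p != q -> theta_top_minor K m1 p q != 0.
Proof.
move=> pq; have [c c0 Ec] := theta_topE.
have xZ j h : xmul j (c *: h) = c *: xmul j h by exact: linearZ.
rewrite /theta_top_minor Ec !xZ -scalerBr.
rewrite scaler_eq0 negb_or c0 /= !xmul_bas subr_eq0.
apply/eqP=> /(congr1 (scoef (Y, (U_(lshift n p) + (U_(rshift n q) + 0))%MM))).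
rewrite !scoef_bas eqxx xpair_eqE eqxx /=.
case: eqP => [E _|_ /eqP]; last by rewrite oner_eq0.
have := congr1 (fun al : 'X_{1..N} => al (lshift n p)) E; rewrite !mnmDE !mnm1E mnm0E.
by rewrite !eq_rlshift eqxx (inj_eq (@lshift_inj _ _)) eq_sym (negPf pq).
Qed.

Lemma Aprime_split : (0 < m1)%N ->
  exists U : A' -> Prop,
    [/\ irreducible T (generated T (theta_top K m1 n)), irreducible T U,
        direct_sum (Aprime K m1 T m1) (generated T (theta_top K m1 n)) U &
        T = first_half n ->
        forall p q : 'I_n, p.+2 = n -> q.+1 = n ->
          forall g, U g <-> generated T (theta_top_minor K m1 p q) g].
Proof.
move=> hm1; have nsgn0 : - sgn != 0 by rewrite oppr_eq0.
have [f Vf f0] := Vsig_neg_neq0 hm1.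
rewrite (Vsig_generated sgn_neq0 theta_top_Vsig theta_top_neq0).
(* The second summand is the other eigenspace of sigma, available for any T with S_1 and T_1 empty
   and also for n = 1; the minor generates it once it is defined and nonzero. *)
exists (Vsig (- sgn)); split.
- exact: Vsig_irreducible sgn_neq0 theta_top_Vsig theta_top_neq0.
- exact: Vsig_irreducible nsgn0 Vf f0.
- split=> [g|g]; last exact: Vsig_cap.
  split=> [/AprimeE Vg|[g1 [g2 [[V1 _] [V2 _] ->]]]].
    have [g1 [g2 [W1 P2 ->]]] := Vsig_split sgn_neq0 (Vsig_Qstable sgn) (fun _ x => x)
      theta_top_Vsig theta_top_neq0 Vg.
    by exists g1, g2; split=> //; apply: Pspan_Vsig P2.
  by apply/AprimeE; apply: (subspaceD (Vcharge_subspace T m1%:Z)).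
move=> TE p q pn qn g.
have pq : p != q by apply/eqP=> E; rewrite E in pn; lia.
by rewrite (Vsig_generated nsgn0 (theta_top_minor_Vsig p q TE) (theta_top_minor_neq0 pq)).
Qed.

End Splitting.

Theorem theorem2 (R : realType) (m1 n : nat) (hm1 : (0 < m1)%N) (hn : (0 < n)%N)
    (T : {set 'I_(n + n)}) (k : nat) :
  (S1 T :|: T1 T != set0 ->
     (T = [set: 'I_(n + n)] -> (k <= m1 + m1)%N) ->
     irreducible T (Aprime R[i] m1 T k)) /\
  (S1 T != set0 -> T1 T != set0 ->
     ~ highest_weight_type T (Aprime R[i] m1 T k)) /\
  (S1 T = set0 -> T1 T = set0 ->
     (k <> m1 -> irreducible T (Aprime R[i] m1 T k)) /\
     (exists U : superpoly R[i] (m1 + m1) (n + n) -> Prop,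
        [/\ irreducible T (generated T (theta_top R[i] m1 n)),
            irreducible T U,
            direct_sum (Aprime R[i] m1 T m1)
              (generated T (theta_top R[i] m1 n)) U &
            T = first_half n ->
            forall p q : 'I_n, p.+2 = n -> q.+1 = n ->
              forall g, U g <-> generated T (theta_top_minor R[i] m1 p q) g])).
Proof.
split; first exact: irreducible_S1T1.
split=> [S1n T1n [f [hf _]]|S10 T10]; first exact: no_highest_weight_vector hf.
by split; [apply: irreducible_neq | apply: Aprime_split].
Qed.
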